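(* Fix $k\ge1$ and assume hypothesis $(\mathrm{H}_k)$: for every $n\ge k$, every $\rho\in[-1,0]$ and every measurable $f:\mathbb{R}^n\to B^k$, $\mathrm{Stab}_\rho[f]\ge\mathrm{Stab}_\rho[f^{(k)}_{\mathrm{opt}}]$ where $f^{(k)}_{\mathrm{opt}}(x)=x_{\le k}/\|x_{\le k}\|$. Let $-1<\rho\le0$. Then for every $\varepsilon>0$ there exist $\delta=\delta(\varepsilon,\rho)>0$ and $m=m(\varepsilon,\rho)\ge0$ such that for every $n$ and every $f=(f_1,\dots,f_k):\{-1,1\}^n\to B^k$ satisfying $\sum_{j=1}^k\mathrm{Inf}^{\le m}_i[f_j]\le\delta$ for all $i\in[n]$, \[\mathbf{Stab}_\rho[f]\ge F^*(k,\rho)-\varepsilon.\]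
   Context: For $f:\{-1,1\}^n\to\mathbb{R}$ with Fourier expansion $f=\sum_{S\subseteq[n]}\hat f(S)\chi_S$, $\chi_S(x)=\prod_{i\in S}x_i$, define $\mathrm{Inf}^{\le m}_i[f]=\sum_{|S|\le m,\,S\ni i}\hat f(S)^2$. For $f=(f_1,\dots,f_k)$, $\mathbf{Stab}_\rho[f]=\mathbb{E}\langle f(\mathbf{x}),f(\mathbf{y})\rangle=\sum_S\rho^{|S|}\sum_j\hat f_j(S)^2$, where $\mathbf{x}$ is uniform on $\{-1,1\}^n$ and each $\mathbf{y}_i$ independently equals $\mathbf{x}_i$ with probability $\tfrac12+\tfrac12\rho$ and $-\mathbf{x}_i$ otherwise. For $g:\mathbb{R}^n\to\mathbb{R}^k$, $\mathrm{Stab}_\rho[g]=\mathbb{E}_{\mathbf{x}\sim_\rho\mathbf{y}}\langle g(\mathbf{x}),g(\mathbf{y})\rangle$ with $\rho$-correlated standard Gaussians. $x_{\le k}=(x_1,\dots,x_k)$. $F^*(k,\rho)=\mathbb{E}\langle\mathbf{Z}u/\|\mathbf{Z}u\|,\mathbf{Z}v/\|\mathbf{Z}v\|\rangle$ for unit vectors $u,v$ with $\langle u,v\rangle=\rho$ and $\mathbf{Z}$ a $k\times m'$ matrix of i.i.d. standard Gaussians (equal to $\mathrm{Stab}_\rho[f^{(k)}_{\mathrm{opt}}]$). *)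

(* Defs.v *)
From HB Require Import structures.
From mathcomp Require Import all_boot all_order all_algebra.
From mathcomp Require Import all_classical all_reals all_analysis.
From mathcomp Require Import normal_distribution.
Set Implicit Arguments.
Unset Strict Implicit.
Unset Printing Implicit Defensive.
Import Order.TTheory GRing.Theory Num.Theory.
Local Open Scope classical_set_scope.
Local Open Scope ring_scope.

Section Defs.
Variable R : realType.

Definition dotp (k : nat) (u v : k.-tuple R) : R :=
  \sum_(i < k) tnth u i * tnth v i.

Definition in_ball (k : nat) (u : k.-tuple R) : Prop := dotp u u <= 1.

(** Expectation with respect to the standard Gaussian measure on R^n,
    written as an iterated integral of one-dimensional standard normal
    integrals (equal, by Fubini, to the integral w.r.t. the product measure
    for the bounded measurable integrands used below). *)
Fixpoint gaussE (n : nat) : (n.-tuple R -> R) -> R :=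
  match n return (n.-tuple R -> R) -> R with
  | 0 => fun F => F [tuple]
  | n'.+1 => fun F =>
      Rintegral (normal_prob (0 : R) 1) setT
        (fun x : R => gaussE (fun t : n'.-tuple R => F (cons_tuple x t)))
  end.

(** y = rho x + sqrt(1 - rho^2) z is rho-correlated with x when x, z are
    independent standard Gaussian vectors *)
Definition corr_mix (n : nat) (rho : R) (x z : n.-tuple R) : n.-tuple R :=
  [tuple rho * tnth x i + Num.sqrt (1 - rho ^+ 2) * tnth z i | i < n].

Definition GStab (n k : nat) (rho : R) (g : n.-tuple R -> k.-tuple R) : R :=
  gaussE (fun x : n.-tuple R =>
    gaussE (fun z : n.-tuple R => dotp (g x) (g (corr_mix rho x z)))).

(** f_opt^{(k)}(x) = x_{<=k} / ||x_{<=k}|| on R^n (value 0 at x_{<=k} = 0,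
    a null set) *)
Definition fopt (k n : nat) (x : n.-tuple R) : k.-tuple R :=
  let xk := [tuple nth 0 x i | i < k] in
  [tuple tnth xk i / Num.sqrt (dotp xk xk) | i < k].

Definition Fstar (k : nat) (rho : R) : R := GStab rho (@fopt k k).

Definition Hyp_k (k : nat) : Prop :=
  forall (n : nat), (k <= n)%N ->
  forall rho : R, -1 <= rho <= 0 ->
  forall f : n.-tuple R -> k.-tuple R,
    measurable_fun setT f -> (forall x, in_ball (f x)) ->
    GStab rho (@fopt k n) <= GStab rho f.

Definition sgn (b : bool) : R := if b then -1 else 1.

Definition chi (n : nat) (S : {set 'I_n}) (x : {ffun 'I_n -> bool}) : R :=
  \prod_(i in S) sgn (x i).

Definition fhat (n : nat) (g : {ffun 'I_n -> bool} -> R) (S : {set 'I_n}) : R :=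
  ((2 ^ n)%:R)^-1 * \sum_(x : {ffun 'I_n -> bool}) g x * chi S x.

Definition Inf_le (n : nat) (m : nat) (i : 'I_n)
    (g : {ffun 'I_n -> bool} -> R) : R :=
  \sum_(S : {set 'I_n} | (#|S| <= m)%N && (i \in S)) fhat g S ^+ 2.

(** Boolean noise stability: x uniform, y_i = x_i w.p. (1+rho)/2 independently *)
Definition BStab (n k : nat) (rho : R)
    (f : {ffun 'I_n -> bool} -> k.-tuple R) : R :=
  \sum_(x : {ffun 'I_n -> bool}) \sum_(y : {ffun 'I_n -> bool})
    ((2 ^ n)%:R)^-1 * (\prod_(i < n) ((1 + rho * sgn (x i) * sgn (y i)) / 2))
      * dotp (f x) (f y).

End Defs.

(* Main.v *)
(* Low-degree invariance.  Let [p] be the degree-[d] part of [T_s f] with [s] close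
   to 1.  Its noise stability is close to that of [f], and [p] is L2-close on the
   cube to the ball-valued function [T_s f], so [E (|p|^2 - 1)_+] is small on the
   cube.  Lindeberg's replacement of the signs by correlated Gaussians, one
   coordinate at a time, transfers this to Gaussian space: the second moment of
   [|p|] is unchanged, and [(1 - w)_+] is uniformly approximated by
   [1 / (1 + w + ... + w^r)], whose composition with [w = |u|^2] has uniformly
   controlled second-order expansions.  The error is bounded by the influences through
   hypercontractivity in the form [E |p|^4 <= (sum_S K^|S| |p_S|^2)^2].
   Rounding the Gaussian extension of [p] into the ball then changes its Gaussian
   stability, which equals [sum_S rho^|S| |p_S|^2], by little, and the hypothesis
   applies to the rounded function.  Only the first two moments and the finiteness
   of the fourth moment of the two marginals are used. *)
Require Import Defs.
From HB Require Import structures.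
From mathcomp Require Import all_boot all_order all_algebra.
From mathcomp Require Import all_classical all_reals all_analysis.
From mathcomp Require Import ring lra measurable_realfun normal_distribution.
Set Implicit Arguments.
Unset Strict Implicit.
Unset Printing Implicit Defensive.
Import Order.TTheory GRing.Theory Num.Theory.
Local Open Scope ring_scope.

(** * Fourier expansions on words *)

(** Smoothing makes truncation harmless: T_s f averages values of f, so it stays in the ball, and
    its part above degree d has norm at most s^d. The bound rho > -1 makes |rho|^N small, so that
    high degrees hardly contribute to the stability. The positive part is the obstacle, since it is
    not smooth and lives on an unbounded range. One writes (w - 1)_+ = w - 1 + (1 - w)_+ with w =
    |p|^2. The mean of w is the same on the cube and in Gaussian space, so only the bounded term (1
    - w)_+ has to be smoothed. Its approximant is rational in w, lies above 1 - w everywhere, and is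
    expanded by multiplying and inverting quadratic polynomials, without derivatives. The excess of
    |p|^2 over 1 concerns one marginal at a time, so the replacement is run for X and for its
    correlated copy Y separately; the pair enters through E XY = rho. Subsets are coded as Boolean
    words so that Fourier coefficients, cube averages and iterated integrals all recurse on the
    first coordinate. *)

Lemma discriminant_le (R : realFieldType) (a b c : R) :
  (forall x, 0 <= a + 2 * x * b + x ^+ 2 * c) -> b ^+ 2 <= a * c.
Proof.
move=> H.
have a0 : 0 <= a by have := H 0; rewrite mulr0 mul0r expr0n /= mul0r !addr0.
have [c0|c0] := eqVneq c 0.
  subst c; rewrite mulr0.
  have [->|b0] := eqVneq b 0; first by rewrite expr0n.
  have := H (- (a + 1) / (2 * b)).
  have -> : a + 2 * (- (a + 1) / (2 * b)) * b + (- (a + 1) / (2 * b)) ^+ 2 * 0 = -1.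
    by field.
  by rewrite oppr_ge0 ler10.
have c_gt0 : 0 < c.
  rewrite lt_neqAle eq_sym c0 /=; rewrite leNgt; apply/negP => cn.
  (* For c < 0 this abscissa is at least 1, and it makes the quadratic at most a + x (c - a), which
     is negative. *)
  have := H ((b ^+ 2 + a + 1) / (- c) + 1).
  set x := (b ^+ 2 + a + 1) / (- c) + 1.
  have xc : x * c = - (b ^+ 2 + a + 1) + c by rewrite /x; field.
  have x1 : 1 <= x.
    by rewrite lerDr divr_ge0 ?oppr_ge0 ?ltW //; have := sqr_ge0 b; lra.
  have -> : a + 2 * x * b + x ^+ 2 * c
     = a + x * (2 * b - (b ^+ 2 + a + 1) + c).
    by rewrite (_ : x ^+ 2 * c = x * (x * c)); [rewrite xc; ring | ring].
  have h1 : 2 * b - (b ^+ 2 + a + 1) + c <= - a + c.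
    by have := sqr_ge0 (b - 1); lra.
  by nra.
have := H (- b / c).
have -> : a + 2 * (- b / c) * b + (- b / c) ^+ 2 * c = (a * c - b ^+ 2) / c.
  by field.
by rewrite pmulr_lge0 ?invr_gt0 // subr_ge0.
Qed.

(** * Inner products of row vectors *)

Section Dot.
Variables (R : realFieldType) (k : nat).
Implicit Types u v : 'rV[R]_k.

Definition dot u v : R := \sum_j u 0 j * v 0 j.

Lemma dotC u v : dot u v = dot v u.
Proof. by apply: eq_bigr => j _; rewrite mulrC. Qed.

Lemma dotDl u v w : dot (u + v) w = dot u w + dot v w.
Proof. by rewrite -big_split; apply: eq_bigr => j _; rewrite !mxE mulrDl. Qed.

Lemma dotZl x u w : dot (x *: u) w = x * dot u w.
Proof. by rewrite mulr_sumr; apply: eq_bigr => j _; rewrite !mxE mulrA. Qed.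

Lemma dotDr u v w : dot u (v + w) = dot u v + dot u w.
Proof. by rewrite !(dotC u) dotDl. Qed.

Lemma dotZr x u w : dot u (x *: w) = x * dot u w.
Proof. by rewrite !(dotC u) dotZl. Qed.

Lemma dot0l u : dot 0 u = 0.
Proof. by rewrite -(scale0r 0) dotZl mul0r. Qed.

Lemma dotBl u v w : dot (u - v) w = dot u w - dot v w.
Proof. by rewrite dotDl -scaleN1r dotZl mulN1r. Qed.

Lemma dotBr u v w : dot u (v - w) = dot u v - dot u w.
Proof. by rewrite !(dotC u) dotBl. Qed.

Lemma dot_ge0 u : 0 <= dot u u.
Proof. by apply: sumr_ge0 => j _; rewrite -expr2 sqr_ge0. Qed.

Lemma dot_quad u v x :
  dot (u + x *: v) (u + x *: v) = dot u u + 2 * x * dot u v + x ^+ 2 * dot v v.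
Proof. by rewrite !dotDl !dotDr !dotZl !dotZr (dotC v u); ring. Qed.

Lemma dotDD u v : dot (u + v) (u + v) = dot u u + 2 * dot u v + dot v v.
Proof. by rewrite -{1 2}[v]scale1r dot_quad; ring. Qed.

Lemma dotBB u v : dot (u - v) (u - v) = dot u u - 2 * dot u v + dot v v.
Proof. by rewrite -{1 2}[v]scale1r -scaleNr dot_quad; ring. Qed.

Lemma dot_CS u v : dot u v ^+ 2 <= dot u u * dot v v.
Proof. by apply: discriminant_le => x; rewrite -dot_quad dot_ge0. Qed.

Lemma dot_young (l : R) u v : 0 < l ->
  `|dot u v| <= (l * dot u u + l^-1 * dot v v) / 2.
Proof.
move=> l0; rewrite ler_norml.
have e1 : l * dot u u + l^-1 * dot v v - 2 * dot u v
        = l * dot (u - l^-1 *: v) (u - l^-1 *: v).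
  by rewrite -scaleNr dot_quad; field; exact: lt0r_neq0.
have e2 : l * dot u u + l^-1 * dot v v + 2 * dot u v
        = l * dot (u + l^-1 *: v) (u + l^-1 *: v).
  by rewrite dot_quad; field; exact: lt0r_neq0.
have := mulr_ge0 (ltW l0) (dot_ge0 (u - l^-1 *: v)).
have := mulr_ge0 (ltW l0) (dot_ge0 (u + l^-1 *: v)).
by rewrite -e1 -e2 => h1 h2; apply/andP; split; lra.
Qed.

Lemma dot_convex (l : R) u v : 0 <= l <= 1 ->
  dot u u <= 1 -> dot v v <= 1 ->
  dot (l *: u + (1 - l) *: v) (l *: u + (1 - l) *: v) <= 1.
Proof.
move=> /andP[l0 l1] hu hv.
rewrite dot_quad !dotZl !dotZr.
have h : 2 * dot u v <= 2.
  by have := dot_young u v ltr01; rewrite ler_norml => /andP[_]; lra.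
have := mulr_ge0 (mulr_ge0 l0 (_ : 0 <= 1 - l)) (_ : 0 <= 2 - 2 * dot u v).
move=> /(_ ltac:(lra) ltac:(lra)) h1.
have h2 : 0 <= l ^+ 2 * (1 - dot u u) by rewrite mulr_ge0 ?sqr_ge0 ?subr_ge0.
have h3 : 0 <= (1 - l) ^+ 2 * (1 - dot v v) by rewrite mulr_ge0 ?sqr_ge0 ?subr_ge0.
by nra.
Qed.

End Dot.

Lemma big_tuple0 (R : Type) (idx : R) (op : Monoid.com_law idx)
  (T : finType) (F : seq T -> R) :
  \big[op/idx]_(t : 0.-tuple T) F t = F [::].
Proof.
by rewrite (big_pred1 [tuple]) // => t; apply/esym/eqP/val_inj; rewrite /= (tuple0 t).
Qed.

Lemma big_tupleS (R : Type) (idx : R) (op : Monoid.com_law idx)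
  (T : finType) n (F : seq T -> R) :
  \big[op/idx]_(t : n.+1.-tuple T) F t
  = \big[op/idx]_(b : T) \big[op/idx]_(t : n.-tuple T) F (b :: t).
Proof.
rewrite pair_big /=.
rewrite (reindex (fun bt : T * n.-tuple T => cons_tuple bt.1 bt.2)) //=.
exists (fun t : n.+1.-tuple T => (thead t, behead_tuple t)) => [[b t]|t] _ /=.
  by congr (_, _); exact/val_inj.
by rewrite [RHS]tuple_eta; exact/val_inj.
Qed.

Section Words.
Variables (R : realFieldType) (k : nat).
Local Notation V := 'rV[R]_k.
Implicit Types (c f : seq bool -> V) (w : seq bool).

Definition sign (b : bool) : R := if b then -1 else 1.

(* The letters of a word [w] record membership in a subset [S], so that
   [count id w = #|S|]. *)
Fixpoint ev c (x : seq R) : V :=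
  if x is x0 :: x' then ev (c \o cons false) x' + x0 *: ev (c \o cons true) x'
  else c [::].

(** Words have two readings: in the argument of [f] the letter [true] is the sign -1, in [w] it is
    membership in S. The letter [false] averages the two restrictions of [f], the letter [true]
    takes half their difference; [hatE] is the closed formula. *)
Fixpoint hat f w : V :=
  if w is b :: w' then
    2^-1 *: (hat (f \o cons false) w' + sign b *: hat (f \o cons true) w')
  else f [::].

Definition bE n (F : seq R -> R) : R :=
  (2 ^+ n)^-1 * \sum_(t : n.-tuple bool) F [seq sign b | b <- t].

(** At K = 1 this is the second moment of the polynomial ([bE_sqr]); for K >= 4 its square bounds
    the fourth moment on the cube ([bE_hypercontract]). *)
Definition wN (K : R) n c : R :=
  \sum_(t : n.-tuple bool) K ^+ count id t * dot (c t) (c t).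

(** Keeps the monomials that contain x_i, so [wN 1 n (restr i c)] is the influence of coordinate
    i. *)
Definition restr i c : seq bool -> V := fun w => if nth false w i then c w else 0.

Lemma sum_tuple0 (F : seq bool -> R) : \sum_(t : 0.-tuple bool) F t = F [::].
Proof. exact: big_tuple0. Qed.

Lemma sum_tupleS n (F : seq bool -> R) :
  \sum_(t : n.+1.-tuple bool) F t
  = \sum_(t : n.-tuple bool) F (false :: t) + \sum_(t : n.-tuple bool) F (true :: t).
Proof. by rewrite big_tupleS big_bool addrC. Qed.

Lemma eq_ev c c' x : c =1 c' -> ev c x = ev c' x.
Proof.
elim: x c c' => [|x0 x IH] c c' e /=; first exact: e.
by congr (_ + _ *: _); apply: IH => w; exact: e.
Qed.

Lemma ev_lin c c' a x : ev (fun w => c w + a *: c' w) x = ev c x + a *: ev c' x.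
Proof.
elim: x c c' => [//|x0 x IH] c c' /=.
rewrite (IH (c \o cons false) (c' \o cons false)).
rewrite (IH (c \o cons true) (c' \o cons true)).
rewrite !scalerDr !scalerA (mulrC x0 a) -!addrA; congr (_ + _).
by rewrite addrCA.
Qed.

Lemma ev_cons c x0 (x : seq R) :
  ev c (x0 :: x) = ev (fun w => c (false :: w) + x0 *: c (true :: w)) x.
Proof. by rewrite (ev_lin (c \o cons false) (c \o cons true)). Qed.

Lemma evZ a c x : ev (fun w => a *: c w) x = a *: ev c x.
Proof.
elim: x c => [//|x0 x IH] c /=.
rewrite (IH (c \o cons false)) (IH (c \o cons true)).
by rewrite scalerDr !scalerA (mulrC a).
Qed.

Lemma evB c c' x : ev (fun w => c w - c' w) x = ev c x - ev c' x.
Proof.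
rewrite -[- ev c' x]scaleN1r -ev_lin.
by apply: eq_ev => w; rewrite scaleN1r.
Qed.

Lemma bE0 F : bE 0 F = F [::].
Proof. by rewrite /bE expr0 invr1 mul1r (sum_tuple0 (fun t => F (map _ t))). Qed.

Lemma bES n F : bE n.+1 F = (bE n (F \o cons 1) + bE n (F \o cons (-1))) / 2.
Proof.
rewrite /bE (sum_tupleS n (fun t => F (map sign t))) /= -mulrDr exprS.
by rewrite invfM -[LHS]mulrA [LHS]mulrC.
Qed.

Lemma eq_bE n F G : (forall w, size w = n ->
    F [seq sign b | b <- w] = G [seq sign b | b <- w]) -> bE n F = bE n G.
Proof.
by move=> e; congr (_ * _); apply: eq_bigr => t _; apply: e; rewrite size_tuple.
Qed.

Lemma le_bE n F G : (forall w, size w = n ->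
    F [seq sign b | b <- w] <= G [seq sign b | b <- w]) -> bE n F <= bE n G.
Proof.
move=> e; rewrite ler_wpM2l ?invr_ge0 ?exprn_ge0 //.
by apply: ler_sum => t _; apply: e; rewrite size_tuple.
Qed.

Lemma bED n F G : bE n (fun x => F x + G x) = bE n F + bE n G.
Proof. by rewrite /bE big_split mulrDr. Qed.

Lemma bEZ n a F : bE n (fun x => a * F x) = a * bE n F.
Proof. by rewrite /bE -mulr_sumr mulrCA. Qed.

Lemma bEc n a : bE n (fun _ => a) = a.
Proof.
elim: n => [|n IH]; first by rewrite bE0.
by rewrite bES /comp IH; field.
Qed.

Lemma bEB n F G : bE n (fun x => F x - G x) = bE n F - bE n G.
Proof. by rewrite /bE sumrB mulrBr. Qed.

Lemma ler_norm_bE n F : `|bE n F| <= bE n (fun x => `|F x|).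
Proof.
rewrite normrM ger0_norm ?invr_ge0 ?exprn_ge0 // ler_wpM2l ?invr_ge0 ?exprn_ge0 //.
exact: ler_norm_sum.
Qed.

Lemma wN0 K c : wN K 0 c = dot (c [::]) (c [::]).
Proof.
rewrite /wN (sum_tuple0 (fun t => K ^+ count id t * dot (c t) (c t))).
by rewrite expr0 mul1r.
Qed.

Lemma wNS K n c :
  wN K n.+1 c = wN K n (c \o cons false) + K * wN K n (c \o cons true).
Proof.
rewrite /wN (sum_tupleS n (fun t => K ^+ count id t * dot (c t) (c t))) /=.
congr (_ + _); rewrite mulr_sumr; apply: eq_bigr => t _.
by rewrite exprS mulrA.
Qed.

Lemma wN_ge0 K n c : 0 <= K -> 0 <= wN K n c.
Proof.
by move=> K0; apply: sumr_ge0 => t _; rewrite mulr_ge0 ?exprn_ge0 ?dot_ge0.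
Qed.

Lemma eq_wN K n c c' : (forall w, c w = c' w) -> wN K n c = wN K n c'.
Proof. by move=> e; apply: eq_bigr => t _; rewrite e. Qed.

(** Fixing the first variable to x turns the coefficients into c0 + x c1, so the norm becomes
    quadratic in x, with a cross term B controlled by Cauchy-Schwarz. The fourth-power inductions
    below rest on this form. *)
Lemma wN_quad K n c c' : 0 <= K -> exists B, [/\ B ^+ 2 <= wN K n c * wN K n c' &
  forall x, wN K n (fun w => c w + x *: c' w)
            = wN K n c + 2 * x * B + x ^+ 2 * wN K n c'].
Proof.
move=> K0.
pose B := \sum_(t : n.-tuple bool) K ^+ count id t * dot (c t) (c' t).
have E x : wN K n (fun w => c w + x *: c' w)
            = wN K n c + 2 * x * B + x ^+ 2 * wN K n c'.
  rewrite /wN /B !mulr_sumr -!big_split; apply: eq_bigr => t _ /=.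
  by rewrite dot_quad; ring.
exists B; split=> //.
by apply: discriminant_le => x; rewrite -E wN_ge0.
Qed.

Lemma restr_lin i c c' x :
  restr i (fun w => c w + x *: c' w) =1 (fun w => restr i c w + x *: restr i c' w).
Proof. by move=> w; rewrite /restr; case: ifP => // _; rewrite scaler0 addr0. Qed.

Lemma infl0 K n c : wN K n.+1 (restr 0 c) = K * wN K n (c \o cons true).
Proof.
rewrite wNS [X in X + _]big1 ?add0r // => t _.
by rewrite /restr /= dot0l mulr0.
Qed.

Lemma inflS K n i c : wN K n.+1 (restr i.+1 c) =
  wN K n (restr i (c \o cons false)) + K * wN K n (restr i (c \o cons true)).
Proof. by rewrite wNS. Qed.

Lemma bE_sqr n c : bE n (fun x => dot (ev c x) (ev c x)) = wN 1 n c.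
Proof.
elim: n c => [|n IH] c; first by rewrite bE0 wN0.
rewrite bES wNS mul1r -!IH -bED mulrC -bEZ -bED.
apply: eq_bE => w _ /=.
by rewrite scale1r scaleN1r dotDD dotBB; field.
Qed.

(** With N0, N1 the norms of the two halves, averaging (N0 + N1 + 2B)^2 and (N0 + N1 - 2B)^2 gives
    (N0 + N1)^2 + 4 B^2. By B^2 <= N0 N1 its cross term is at most 6 N0 N1, which the 2K N0 N1 of
    (N0 + K N1)^2 covers. *)
Lemma bE_hypercontract K n c : 4 <= K ->
  bE n (fun x => dot (ev c x) (ev c x) ^+ 2) <= wN K n c ^+ 2.
Proof.
move=> K4; elim: n c => [|n IH] c; first by rewrite bE0 wN0.
pose c0 := c \o cons false; pose c1 := c \o cons true.
have K0 : 0 <= K by lra.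
have [B [hB E]] := wN_quad n c0 c1 K0.
rewrite bES wNS -/c0 -/c1.
have step x : bE n (fun y => dot (ev c (x :: y)) (ev c (x :: y)) ^+ 2) <=
    (wN K n c0 + 2 * x * B + x ^+ 2 * wN K n c1) ^+ 2.
  rewrite -E; apply: le_trans (IH _); apply: le_bE => w _.
  by rewrite ev_cons.
have h1 := step 1; have h2 := step (-1).
have p0 := wN_ge0 n c0 K0; have p1 := wN_ge0 n c1 K0.
have p01 := mulr_ge0 p0 p1.
rewrite /comp in h1 h2 *.
rewrite ler_pdivrMr //; apply: le_trans (lerD h1 h2) _.
have h3 := mulr_ge0 (_ : 0 <= K - 3) p01.
have h4 := mulr_ge0 (_ : 0 <= K ^+ 2 - 1) (sqr_ge0 (wN K n c1)).
move: (h3 ltac:(lra)) (h4 ltac:(nra)) => {}h3 {}h4.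
by nra.
Qed.

(** Undoing one coordinate of the noise operator leaves a convex combination of the smoothed
    restrictions of [f], and the ball is convex. *)
Lemma smooth_in_ball s f w : 0 <= s <= 1 -> (forall w, dot (f w) (f w) <= 1) ->
  let u := ev (fun v => s ^+ count id v *: hat f v) [seq sign b | b <- w] in
  dot u u <= 1.
Proof.
move=> hs; elim: w f => [|b w IH] f hf /=; first by rewrite expr0 scale1r.
pose P g := ev (fun v => s ^+ count id v *: hat g v) [seq sign b | b <- w].
pose f0 := f \o cons false; pose f1 := f \o cons true.
have -> : ev ((fun v => s ^+ count id v *: hat f v) \o cons false)
    [seq sign b | b <- w] = 2^-1 *: (P f0 + P f1).
  rewrite -[P f1]scale1r -ev_lin -evZ; apply: eq_ev => v /=.
  by rewrite add0n !scale1r -scalerDr !scalerA mulrC.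
have -> : ev ((fun v => s ^+ count id v *: hat f v) \o cons true)
    [seq sign b | b <- w] = (s / 2) *: (P f0 - P f1).
  rewrite -evB -evZ; apply: eq_ev => v /=.
  rewrite add1n exprS scaleN1r scalerBr !scalerBr !scalerA.
  by congr (_ *: _ - _ *: _); field.
(* The probability that an s-correlated copy of the sign [sign b] equals +1. *)
set l := (1 + sign b * s) / 2.
have hl : 0 <= l <= 1 by rewrite /l /sign; case: (b); lra.
have -> : 2^-1 *: (P f0 + P f1) + sign b *: (s / 2 *: (P f0 - P f1))
   = l *: P f0 + (1 - l) *: P f1.
  by apply/rowP => j; rewrite !mxE /l; field.
by apply: dot_convex => //; apply: IH => v; exact: hf.
Qed.

Lemma Parseval_le1 n f : (forall w, dot (f w) (f w) <= 1) -> wN 1 n (hat f) <= 1.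
Proof.
elim: n f => [|n IH] f hf; first by rewrite wN0; exact: hf.
pose f0 := f \o cons false; pose f1 := f \o cons true.
have -> : wN 1 n.+1 (hat f) = (wN 1 n (hat f0) + wN 1 n (hat f1)) / 2.
  rewrite wNS mul1r /wN -!big_split mulr_suml; apply: eq_bigr => t _ /=.
  rewrite expr1n !mul1r !dotZl !dotZr scale1r scaleN1r dotDD dotBB.
  by field.
have h0 := IH f0 (fun w => hf (false :: w)).
have h1 := IH f1 (fun w => hf (true :: w)).
by rewrite ler_pdivrMr //; lra.
Qed.

End Words.

(** * Second-order expansion of the test function *)

Section Taylor.
Variable R : realFieldType.
Implicit Types (C M : R) (v : R -> R).

Definition quad (g0 g1 g2 s : R) : R := g0 + g1 * s + g2 * s ^+ 2.

(* Second-order expansion of [v] at [0] in the rescaled variable [M * t],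
   valid for [|M * t| <= 1], with constants uniform in [M]. *)
Definition expand2 C M v := exists g0 g1 g2 : R,
  [/\ `|g0| <= C, `|g1| <= C, `|g2| <= C &
      forall t, `|M * t| <= 1 ->
        `|v t - quad g0 g1 g2 (M * t)| <= C * `|M * t| ^+ 3].

Lemma quad_le C g0 g1 g2 s : 0 <= C -> `|g0| <= C -> `|g1| <= C -> `|g2| <= C ->
  `|s| <= 1 -> `|quad g0 g1 g2 s| <= 3 * C.
Proof.
move=> C0 h0 h1 h2 hs; rewrite /quad.
have e1 : `|g1 * s| <= C by rewrite normrM -[C]mulr1 ler_pM.
have e2 : `|g2 * s ^+ 2| <= C.
  by rewrite normrM normrX -[C]mulr1 ler_pM // ?exprn_ge0 // exprn_ile1.
have := ler_normD (g0 + g1 * s) (g2 * s ^+ 2).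
by have := ler_normD g0 (g1 * s); lra.
Qed.

Lemma expand2_ge0 C M v : expand2 C M v -> 0 <= C.
Proof. by move=> [g0 [? [? [h _ _ _]]]]; exact: le_trans h. Qed.

Lemma expand2_quad C M g0 g1 g2 : `|g0| <= C -> `|g1| <= C -> `|g2| <= C ->
  expand2 C M (fun t => quad g0 g1 g2 (M * t)).
Proof.
move=> h0 h1 h2; exists g0, g1, g2; split=> // t _.
by rewrite subrr normr0 mulr_ge0 ?exprn_ge0 //; exact: le_trans h0.
Qed.

Lemma eq_expand2 C M v v' : v =1 v' -> expand2 C M v -> expand2 C M v'.
Proof.
move=> e [g0 [g1 [g2 [h0 h1 h2 h]]]]; exists g0, g1, g2; split=> // t ht.
by rewrite -e h.
Qed.

Lemma expand2_cst C M a : `|a| <= C -> expand2 C M (fun _ => a).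
Proof.
move=> ha; have C0 : 0 <= C by exact: le_trans ha.
apply: eq_expand2 (@expand2_quad C M a 0 0 ha _ _); rewrite ?normr0 // => t.
by rewrite /quad !mul0r !addr0.
Qed.

Lemma expand2D C1 C2 M v1 v2 : expand2 C1 M v1 -> expand2 C2 M v2 ->
  expand2 (C1 + C2) M (fun t => v1 t + v2 t).
Proof.
move=> [g0 [g1 [g2 [h0 h1 h2 h]]]] [k0 [k1 [k2 [l0 l1 l2 l]]]].
exists (g0 + k0), (g1 + k1), (g2 + k2).
have D (x y : R) : `|x| <= C1 -> `|y| <= C2 -> `|x + y| <= C1 + C2.
  by move=> hx hy; apply: le_trans (ler_normD _ _) _; exact: lerD.
split; [exact: D | exact: D | exact: D | move=> t ht].
have -> : v1 t + v2 t - quad (g0 + k0) (g1 + k1) (g2 + k2) (M * t)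
  = (v1 t - quad g0 g1 g2 (M * t)) + (v2 t - quad k0 k1 k2 (M * t)).
  by rewrite /quad; ring.
by apply: le_trans (ler_normD _ _) _; rewrite mulrDl lerD ?h ?l.
Qed.

Lemma ler_normM2 (x y a b : R) : `|x| <= a -> `|y| <= b -> `|x * y| <= a * b.
Proof. by move=> hx hy; rewrite normrM ler_pM. Qed.

(** The 10 is 4 + 3 + 3: |v2| <= 4 C2 and |P1| <= 3 C1 multiply the two remainders, and three
    products of coefficients survive in degrees 3 and 4 of P1 P2. *)
Lemma expand2M C1 C2 M v1 v2 : expand2 C1 M v1 -> expand2 C2 M v2 ->
  expand2 (10 * C1 * C2) M (fun t => v1 t * v2 t).
Proof.
move=> H1 H2; have p1 := expand2_ge0 H1; have p2 := expand2_ge0 H2.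
case: H1 H2 => [g0 [g1 [g2 [h0 h1 h2 h]]]] [k0 [k1 [k2 [l0 l1 l2 l]]]].
have p12 := mulr_ge0 p1 p2.
exists (g0 * k0), (g0 * k1 + g1 * k0), (g0 * k2 + g1 * k1 + g2 * k0).
have n00 := ler_normM2 h0 l0; have n01 := ler_normM2 h0 l1.
have n10 := ler_normM2 h1 l0; have n02 := ler_normM2 h0 l2.
have n11 := ler_normM2 h1 l1; have n20 := ler_normM2 h2 l0.
have n12 := ler_normM2 h1 l2; have n21 := ler_normM2 h2 l1.
have n22 := ler_normM2 h2 l2.
split.
- by lra.
- by have := ler_normD (g0 * k1) (g1 * k0); lra.
- have := ler_normD (g0 * k2 + g1 * k1) (g2 * k0).
  by have := ler_normD (g0 * k2) (g1 * k1); lra.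
move=> t ht; set s := M * t.
set P1 := quad g0 g1 g2 s; set P2 := quad k0 k1 k2 s.
have hs3 : 0 <= `|s| ^+ 3 by rewrite exprn_ge0.
have -> : v1 t * v2 t
    - quad (g0 * k0) (g0 * k1 + g1 * k0) (g0 * k2 + g1 * k1 + g2 * k0) s
  = (v1 t - P1) * v2 t + P1 * (v2 t - P2)
    + ((g1 * k2 + g2 * k1) + g2 * k2 * s) * s ^+ 3.
  by rewrite /P1 /P2 /quad; ring.
have b1 : `|v1 t - P1| <= C1 * `|s| ^+ 3 by exact: h.
have b2 : `|v2 t - P2| <= C2 * `|s| ^+ 3 by exact: l.
have bP1 : `|P1| <= 3 * C1 by exact: quad_le.
have bP2 : `|P2| <= 3 * C2 by exact: quad_le.
have bv2 : `|v2 t| <= 4 * C2.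
  have -> : v2 t = (v2 t - P2) + P2 by ring.
  have : C2 * `|s| ^+ 3 <= C2 by rewrite ler_piMr // exprn_ile1.
  by have := ler_normD (v2 t - P2) P2; lra.
have t1 := ler_normM2 b1 bv2.
have t2 := ler_normM2 bP1 b2.
have t3 : `|((g1 * k2 + g2 * k1) + g2 * k2 * s) * s ^+ 3|
    <= (3 * (C1 * C2)) * `|s| ^+ 3.
  apply: ler_normM2; last by rewrite normrX.
  have hs : `|g2 * k2 * s| <= C1 * C2 * 1 by apply: ler_normM2.
  have := ler_normD (g1 * k2 + g2 * k1) (g2 * k2 * s).
  by have := ler_normD (g1 * k2) (g2 * k1); lra.
apply: le_trans (ler_normD _ _) _.
apply: le_trans (lerD (ler_normD _ _) (lexx _)) _.
apply: le_trans (lerD (lerD t1 t2) t3) _.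
by rewrite le_eqVlt; apply/orP; left; apply/eqP; ring.
Qed.

(** The new coefficients are those of the formal inverse of g0 + g1 s + g2 s^2 modulo s^3, each
    bounded by Q. The remainder is (1 - v q) / v, where 1 - v q is at most 6 C Q |s|^3 and 1 / v at
    most L. *)
Lemma expand2V C kap M v : 0 < kap -> expand2 C M v ->
  (forall t, `|M * t| <= 1 -> kap <= v t) ->
  let L := kap^-1 in let Q := L + C * L ^+ 2 + C ^+ 2 * L ^+ 3 in
  expand2 (Q + 6 * C * Q * L) M (fun t => (v t)^-1).
Proof.
move=> k0 H lb L Q; have C0 := expand2_ge0 H.
case: H => [g0 [g1 [g2 [h0 h1 h2 h]]]].
have L0 : 0 < L by rewrite invr_gt0.
have g0E : g0 = v 0.
  have := h 0; rewrite mulr0 normr0 ler01 => /(_ isT).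
  rewrite (_ : quad g0 g1 g2 0 = g0); last by rewrite /quad; ring.
  by rewrite expr0n mulr0 normr_le0 subr_eq0 => /eqP.
have g0k : kap <= g0 by rewrite g0E lb // mulr0 normr0.
have g0p : 0 < g0 by exact: lt_le_trans g0k.
have nz : g0 != 0 by exact: lt0r_neq0.
have gV : `|g0^-1| <= L.
  by rewrite ger0_norm ?invr_ge0 ?(ltW g0p) // /L lef_pV2 ?posrE.
pose q1 := - g1 * g0^-1 ^+ 2; pose q2 := g1 ^+ 2 * g0^-1 ^+ 3 - g2 * g0^-1 ^+ 2.
have CL2 : 0 <= C * L ^+ 2 by rewrite mulr_ge0 ?exprn_ge0 // ltW.
have CL3 : 0 <= C ^+ 2 * L ^+ 3 by rewrite mulr_ge0 ?exprn_ge0 // ltW.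
have Q0 : 0 <= Q by rewrite /Q; lra.
have X (n : nat) : `|g0^-1 ^+ n| <= L ^+ n by rewrite normrX lerXn2r ?nnegrE // ltW.
have bq0 : `|g0^-1| <= Q by rewrite /Q; lra.
have bq1 : `|q1| <= Q.
  have := ler_normM2 (_ : `|- g1| <= C) (X 2); rewrite normrN => /(_ h1).
  by rewrite /q1 /Q; lra.
have bq2 : `|q2| <= Q.
  have a1 : `|g1 ^+ 2 * g0^-1 ^+ 3| <= C ^+ 2 * L ^+ 3.
    by apply: ler_normM2 => //; rewrite normrX lerXn2r ?nnegrE.
  have a2 := ler_normM2 h2 (X 2).
  have := ler_normB (g1 ^+ 2 * g0^-1 ^+ 3) (g2 * g0^-1 ^+ 2).
  by rewrite -/q2 /Q; lra.
have CQL : 0 <= 6 * C * Q * L by rewrite !mulr_ge0 // ltW.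
exists g0^-1, q1, q2; split; [by lra | by lra | by lra | move=> t ht].
set s := M * t; set P := quad g0 g1 g2 s; set q := quad g0^-1 q1 q2 s.
have hs3 : 0 <= `|s| ^+ 3 by rewrite exprn_ge0.
have vk := lb t ht; have vp : 0 < v t by exact: lt_le_trans vk.
have -> : (v t)^-1 - q
  = (- ((g1 * q2 + g2 * q1) + g2 * q2 * s) * s ^+ 3 - (v t - P) * q) * (v t)^-1.
  by rewrite /q /P /quad /q1 /q2; field; rewrite ?nz ?(lt0r_neq0 vp).
have bq : `|q| <= 3 * Q by exact: quad_le.
have bv : `|(v t)^-1| <= L.
  by rewrite ger0_norm ?invr_ge0 ?(ltW vp) // /L lef_pV2 ?posrE.
have t1 := ler_normM2 (h t ht) bq.
have t2 : `|- ((g1 * q2 + g2 * q1) + g2 * q2 * s) * s ^+ 3|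
    <= (3 * (C * Q)) * `|s| ^+ 3.
  apply: ler_normM2; last by rewrite normrX.
  rewrite normrN.
  have n22 : `|g2 * q2 * s| <= C * Q * 1 by do 2 apply: ler_normM2 => //.
  have n12 := ler_normM2 h1 bq2; have n21 := ler_normM2 h2 bq1.
  have := ler_normD (g1 * q2 + g2 * q1) (g2 * q2 * s).
  by have := ler_normD (g1 * q2) (g2 * q1); lra.
have t3 : `|- ((g1 * q2 + g2 * q1) + g2 * q2 * s) * s ^+ 3 - (v t - P) * q|
   <= 6 * C * Q * `|s| ^+ 3.
  apply: le_trans (ler_normB _ _) _; apply: le_trans (lerD t2 t1) _.
  by rewrite le_eqVlt; apply/orP; left; apply/eqP; rewrite -/s; ring.
apply: le_trans (ler_normM2 t3 bv) _.
rewrite [leLHS]mulrAC -/s ler_wpM2r // lerDr //.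
Qed.

(* [1 / (1 + w + ... + w^r)] converges to the positive part of [1 - w] uniformly
   on [w >= 0]. *)
Definition er (r : nat) (w : R) : R := (\sum_(i < r.+1) w ^+ i)^-1.

Lemma geom_sum_gt0 (r : nat) (w : R) : 0 <= w -> 1 <= \sum_(i < r.+1) w ^+ i.
Proof.
move=> w0; rewrite big_ord_recl expr0 lerDl.
by apply: sumr_ge0 => i _; rewrite exprn_ge0.
Qed.

Lemma er_bounds r w : 0 <= w -> 0 <= er r w <= 1.
Proof.
move=> w0; have h := geom_sum_gt0 r w0.
by rewrite /er invr_ge0 invf_le1 ?h ?andbT; [lra | exact: lt_le_trans h].
Qed.

(** The geometric sum times 1 - w is 1 - w^(r+1), at most 1. Having no error term here keeps w - 1 +
    [er r w] above the positive part of w - 1. *)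
Lemma er_ge r w : 0 <= w -> 1 - w <= er r w.
Proof.
move=> w0; have h := geom_sum_gt0 r w0.
have Sp : 0 < \sum_(i < r.+1) w ^+ i by exact: lt_le_trans h.
rewrite /er -[leRHS]mul1r ler_pdivlMr //.
have := subrX1 w r.+1; have := exprn_ge0 r.+1 w0; nra.
Qed.

(** For w >= 1 the sum has r + 1 terms, each at least 1. For w < 1 the gap to 1 - w is w^(r+1) over
    the sum, and each term of the sum is at least w^(r+1). *)
Lemma er_le r w : 0 <= w -> er r w <= Num.max (1 - w) 0 + r.+1%:R^-1.
Proof.
move=> w0; have h := geom_sum_gt0 r w0.
have Sp : 0 < \sum_(i < r.+1) w ^+ i by exact: lt_le_trans h.
have rp : 0 < r.+1%:R :> R by rewrite ltr0n.
have [w1|w1] := leP 1 w.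
  have m0 : 0 <= Num.max (1 - w) 0 by rewrite le_max lexx orbT.
  apply: le_trans (_ : r.+1%:R^-1 <= _); last by rewrite lerDr.
  rewrite /er lef_pV2 ?posrE // -[r.+1 in leLHS]card_ord -sumr_const.
  by apply: ler_sum => i _; rewrite exprn_ege1.
have -> : Num.max (1 - w) 0 = 1 - w by apply/max_idPl; lra.
have bnd : r.+1%:R * w ^+ r.+1 <= \sum_(i < r.+1) w ^+ i.
  rewrite mulr_natl -[X in _ *+ X]card_ord -sumr_const.
  by apply: ler_sum => i _; rewrite ler_wiXn2l ?(ltW w1) ?(ltnW (ltn_ord i)).
have e : er r w - (1 - w) = w ^+ r.+1 / \sum_(i < r.+1) w ^+ i.
  apply: (mulIf (lt0r_neq0 Sp)); rewrite divfK ?lt0r_neq0 // mulrBl mulVf ?lt0r_neq0 //.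
  by have := subrX1 w r.+1; lra.
rewrite -lerBlDl e ler_pdivrMr // ler_pdivlMl //.
Qed.

(** Keeps the denominator bounded below after division by a power of 1 + w, uniformly in w. *)
Lemma geom_sum_ge r (w : R) : 0 <= w -> (1 + w) ^+ r <= 2 ^+ r * \sum_(i < r.+1) w ^+ i.
Proof.
move=> w0; have [w1|w1] := leP 1 w.
  apply: le_trans (_ : 2 ^+ r * w ^+ r <= _).
    by rewrite -exprMn lerXn2r ?nnegrE; lra.
  rewrite ler_wpM2l ?exprn_ge0 // big_ord_recr /= lerDr.
  by apply: sumr_ge0 => i _; rewrite exprn_ge0.
apply: le_trans (_ : 2 ^+ r * 1 <= _).
  by rewrite mulr1 lerXn2r ?nnegrE; lra.
by rewrite ler_wpM2l ?exprn_ge0 // geom_sum_gt0.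
Qed.

(** The sum is homogenised because it is used with w / (1 + A) and 1 / (1 + A), whose expansions are
    bounded uniformly in A, unlike that of w. *)
Lemma expand2_geom r : exists C, forall M (a : R -> R) b,
  expand2 1 M a -> `|b| <= 1 ->
  expand2 C M (fun t => \sum_(i < r.+1) a t ^+ i * b ^+ (r - i)).
Proof.
elim: r => [|r [C IH]].
  exists 1 => M a b _ _; apply: (@eq_expand2 _ _ (fun _ => 1)) => [t|].
    by rewrite big_ord_recl big_ord0 !expr0 mul1r addr0.
  by apply: expand2_cst; rewrite normr1.
exists (10 * 1 * C + 10 ^+ r.+1) => M a b ha hb.
have hX j : expand2 (10 ^+ j) M (fun t => a t ^+ j).
  elim: j => [|j IHj].
    by apply: expand2_cst; rewrite expr0 normr1.
  have := expand2M ha IHj; rewrite mulr1 -exprS.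
  by apply: eq_expand2 => t; rewrite exprS.
have := expand2D (expand2M (expand2_cst M hb) (IH _ _ _ ha hb)) (hX r.+1).
apply: eq_expand2 => t; rewrite [RHS]big_ord_recr /= subnn expr0 mulr1.
congr (_ + _); rewrite mulr_sumr; apply: eq_bigr => i _.
by rewrite subSn ?exprS; [ring | rewrite -ltnS].
Qed.

(** Dividing w by 1 + A, its value at t = 0 plus one, makes all coefficients in the variable M t at
    most 1: the linear one because 2 |B| <= 2 sqrt(A) M <= (1 + A) M. *)
Lemma expand2_er r : exists C, forall M A B, 0 <= M -> 0 <= A ->
  B ^+ 2 <= A * M ^+ 2 ->
  expand2 C M (fun t => er r (A + 2 * t * B + t ^+ 2 * M ^+ 2)).
Proof.
have [C0 HC] := expand2_geom r.
pose kap : R := (6 ^+ r)^-1; pose L := kap^-1.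
pose Q := L + C0 * L ^+ 2 + C0 ^+ 2 * L ^+ 3.
exists (10 * 1 * (Q + 6 * C0 * Q * L)) => M A B M0 A0 hB.
have W0 : 0 < 1 + A by lra.
have Wn : 1 + A != 0 by exact: lt0r_neq0.
pose w t := A + 2 * t * B + t ^+ 2 * M ^+ 2.
have w_ge0 t : 0 <= w t.
  have [M00|Mn] := eqVneq M 0.
    have : B ^+ 2 <= 0 by rewrite M00 expr0n mulr0 in hB.
    rewrite exprn_even_le0 //= => /eqP B0.
    by rewrite /w B0 M00 expr0n !mulr0 !addr0.
  have Mp : 0 < M ^+ 2 by rewrite exprn_gt0 // lt_neqAle eq_sym Mn.
  rewrite -(pmulr_lge0 _ Mp) /w.
  have -> : (A + 2 * t * B + t ^+ 2 * M ^+ 2) * M ^+ 2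
    = (A * M ^+ 2 - B ^+ 2) + (B + t * M ^+ 2) ^+ 2 by ring.
  by rewrite addr_ge0 ?sqr_ge0 // subr_ge0.
pose b := (1 + A)^-1; pose a t := w t / (1 + A).
have b1 : `|b| <= 1.
  by rewrite ger0_norm /b ?invr_ge0 ?invf_le1 //; lra.
have ha : expand2 1 M a.
  have g0 : `|A / (1 + A)| <= 1.
    by rewrite ger0_norm ?divr_ge0 ?ler_pdivrMr // ; lra.
  have hB2 : `|2 * B| <= (1 + A) * M.
    rewrite -(@ler_pXn2r _ 2) ?nnegrE // ?mulr_ge0 //; last lra.
    rewrite -normrX ger0_norm ?sqr_ge0 // !exprMn.
    have h4 : 0 <= (1 - A) ^+ 2 * M ^+ 2 by rewrite mulr_ge0 ?sqr_ge0.
    by nra.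
  (* For M = 0 the quotient is 0 by convention, which is the right coefficient since then B = 0. *)
  have g1 : `|2 * B / M / (1 + A)| <= 1.
    rewrite normrM normfV (ger0_norm (ltW W0)) ler_pdivrMr // mul1r.
    have [->|Mn] := eqVneq M 0; first by rewrite invr0 mulr0 normr0 ltW.
    rewrite normrM normfV (ger0_norm M0) ler_pdivrMr // lt_neqAle eq_sym Mn //.
  apply: eq_expand2 (expand2_quad M g0 g1 b1) => t.
  rewrite /quad /a /w /b.
  have [M00|Mn] := eqVneq M 0; last by field; rewrite Wn.
  have : B ^+ 2 <= 0 by rewrite M00 expr0n mulr0 in hB.
  rewrite exprn_even_le0 //= => /eqP B0.
  by rewrite B0 M00 !mulr0 !mul0r expr0n !mulr0 !addr0 .
have hD := HC M a b ha b1.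
have eD t : \sum_(i < r.+1) a t ^+ i * b ^+ (r - i)
    = (\sum_(i < r.+1) w t ^+ i) / (1 + A) ^+ r.
  rewrite mulr_suml; apply: eq_bigr => i _.
  rewrite /a /b exprMn -mulrA -exprD subnKC ?exprVn // -ltnS ltn_ord //.
have lb t : `|M * t| <= 1 -> kap <= \sum_(i < r.+1) a t ^+ i * b ^+ (r - i).
  move=> ht; rewrite eD /kap ler_pdivlMr ?exprn_gt0 // ler_pdivrMl ?exprn_gt0 //.
  (* In the window |M t| <= 1 the value w t cannot fall far below w 0 = A. This gives a factor 3^r,
     and [geom_sum_ge] another 2^r, whence the constant 6^r in [kap]. *)
  have hW : 1 + A <= 3 * (1 + w t).
    have s1 : (M * t) ^+ 2 <= 1 by rewrite -real_normK ?num_real // exprn_ile1.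
    have h5 : A <= 2 * (w t + (M * t) ^+ 2).
      have [M00|Mn] := eqVneq M 0.
        have : B ^+ 2 <= 0 by rewrite M00 expr0n mulr0 in hB.
        rewrite exprn_even_le0 //= => /eqP B0.
        by rewrite /w B0 M00 mul0r !expr0n !mulr0 !addr0; lra.
      have Mp : 0 < M ^+ 2 by rewrite exprn_gt0 // lt_neqAle eq_sym Mn.
      rewrite -(ler_pM2r Mp) /w.
      have h6 : 0 <= (B + 2 * t * M ^+ 2) ^+ 2 by exact: sqr_ge0.
      have -> : 2 * (A + 2 * t * B + t ^+ 2 * M ^+ 2 + (M * t) ^+ 2) * M ^+ 2
        = A * M ^+ 2 + (A * M ^+ 2 - B ^+ 2) + (B + 2 * t * M ^+ 2) ^+ 2 by ring.
      by lra.
    by have := w_ge0 t; lra.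
  apply: le_trans (_ : (3 * (1 + w t)) ^+ r <= _).
    by rewrite lerXn2r ?nnegrE //; have := w_ge0 t; lra.
  rewrite exprMn (_ : 6 = 3 * 2 :> R); last by ring.
  by rewrite exprMn -mulrA ler_wpM2l ?exprn_ge0 // geom_sum_ge.
have kp : 0 < kap by rewrite invr_gt0 exprn_gt0.
have br1 : `|b ^+ r| <= 1 by rewrite normrX exprn_ile1.
have := expand2M (expand2_cst M br1) (expand2V kp hD lb).
apply: eq_expand2 => t.
rewrite eD invfM invrK /b exprVn mulrCA mulVf ?mulr1 //.
by rewrite expf_neq0.
Qed.

End Taylor.

(** The cubic remainder carries |b|^3. Splitting it by AM-GM into l |b|^2 and l^-1 |b|^4 leaves
    polynomials in the coordinates, whose means the coefficient norms control. *)
Lemma er_taylor (R : rcfType) (r : nat) : exists2 C : R, 0 <= C &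
  forall k (a b : 'rV[R]_k) (l : R), 0 < l -> exists g0 g1 g2, forall t,
    `|er r (dot (a + t *: b) (a + t *: b)) - quad g0 g1 g2 t|
    <= C * (l * dot b b + l^-1 * dot b b ^+ 2) * `|t| ^+ 3.
Proof.
have [C HC] := expand2_er R r.
exists (1 + 3 * `|C|); first by rewrite addr_ge0 ?mulr_ge0.
move=> k a b l l0.
pose M := Num.sqrt (dot b b).
have M0 : 0 <= M by exact: sqrtr_ge0.
have M2 : M ^+ 2 = dot b b by rewrite sqr_sqrtr ?dot_ge0.
have H := HC M (dot a a) (dot a b) M0 (dot_ge0 a).
rewrite M2 in H; move: (H (dot_CS a b)) => {}H.
have C0 := expand2_ge0 H; rewrite (ger0_norm C0).
case: H => g0 [g1 [g2 [h0 h1 h2 h]]].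
exists g0, (g1 * M), (g2 * M ^+ 2) => t.
have -> : quad g0 (g1 * M) (g2 * M ^+ 2) t = quad g0 g1 g2 (M * t).
  by rewrite /quad; ring.
set s := M * t.
have key : `|er r (dot (a + t *: b) (a + t *: b)) - quad g0 g1 g2 s|
    <= (1 + 3 * C) * `|s| ^+ 3.
  have s3 : 0 <= `|s| ^+ 3 by rewrite exprn_ge0.
  have [s1|s1] := leP `|s| 1.
    rewrite dot_quad; apply: le_trans (h t s1) _.
    by rewrite ler_wpM2r //; lra.
  (* Outside the window no expansion is used: [er] is at most 1 and the quadratic at most 3 C
     |s|^3. *)
  have bt : `|er r (dot (a + t *: b) (a + t *: b))| <= 1.
    by have /andP[e0 e1] := er_bounds r (dot_ge0 (a + t *: b)); rewrite ger0_norm.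
  have s1' := ltW s1.
  have e3 : 1 <= `|s| ^+ 3 by rewrite exprn_ege1.
  have e1 : `|s| <= `|s| ^+ 3 by rewrite -[leLHS]expr1 ler_weXn2l.
  have e2 : `|s ^+ 2| <= `|s| ^+ 3 by rewrite normrX ler_weXn2l.
  have q1 := ler_normM2 h1 e1; have q2 := ler_normM2 h2 e2.
  have q0 : `|g0| <= C * `|s| ^+ 3.
    by apply: le_trans h0 _; rewrite ler_peMr.
  apply: le_trans (ler_normB _ _) _; rewrite /quad.
  have n1 := ler_normD (g0 + g1 * s) (g2 * s ^+ 2).
  have n2 := ler_normD g0 (g1 * s).
  by move: s3 e3 q0 q1 q2 n1 n2 bt; lra.
apply: le_trans key _.
rewrite -mulrA ler_wpM2l //; first lra.
rewrite /s normrM exprMn (ger0_norm M0) ler_wpM2r ?exprn_ge0 //.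
rewrite -M2.
have -> : l * M ^+ 2 + l^-1 * (M ^+ 2) ^+ 2
   = M ^+ 3 + (l^-1 * (M * (l - M)) ^+ 2 + M ^+ 3).
  by field; exact: lt0r_neq0.
rewrite lerDl addr_ge0 ?exprn_ge0 // mulr_ge0 ?sqr_ge0 // invr_ge0 ltW //.
Qed.

(** * Words and the Boolean cube *)

Section Fourier.
Variables (R : realFieldType) (k : nat).
Local Notation V := 'rV[R]_k.
Implicit Types (f g : seq bool -> V).

(** Joint mass of the correlated pair: the uniform factor 1/2 of each x_i is absorbed, hence the
    4. *)
Definition noise_weight (rho : R) n (x y : seq bool) : R :=
  \prod_(i < n) ((1 + rho * sign R (nth false x i) * sign R (nth false y i)) / 4).

Lemma noise_weightS rho n a b x y : noise_weight rho n.+1 (a :: x) (b :: y)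
  = (1 + rho * sign R a * sign R b) / 4 * noise_weight rho n x y.
Proof. by rewrite /noise_weight big_ord_recl. Qed.

Lemma noise_stab_hat rho n f g :
  \sum_(x : n.-tuple bool) \sum_(y : n.-tuple bool)
    noise_weight rho n x y * dot (f x) (g y)
  = \sum_(w : n.-tuple bool) rho ^+ count id w * dot (hat f w) (hat g w).
Proof.
pose G n f g (x : seq bool) :=
  \sum_(y : n.-tuple bool) noise_weight rho n x y * dot (f x) (g y).
pose S n f g := \sum_(x : n.-tuple bool) G n f g x.
pose H n f g := \sum_(w : n.-tuple bool) rho ^+ count id w * dot (hat f w) (hat g w).
suff : S n f g = H n f g by [].
elim: n f g => [|n IH] f g.
  rewrite /S /H (sum_tuple0 (G 0%N f g)) /G.
  rewrite (sum_tuple0 (fun y => noise_weight rho 0 [::] y * dot (f [::]) (g y))).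
  rewrite (sum_tuple0 (fun w => rho ^+ count id w * dot (hat f w) (hat g w))).
  by rewrite /noise_weight big_ord0.
pose fb b := f \o cons b; pose gb b := g \o cons b.
have E b : \sum_(x : n.-tuple bool) G n.+1 f g (b :: x)
  = (1 + rho * sign R b * 1) / 4 * S n (fb b) (gb false)
    + (1 + rho * sign R b * -1) / 4 * S n (fb b) (gb true).
  rewrite /S !mulr_sumr -big_split; apply: eq_bigr => x _ /=.
  rewrite {1}/G (sum_tupleS n (fun y => noise_weight rho n.+1 (b :: x) y *
     dot (f (b :: x)) (g y))).
  rewrite /G !mulr_sumr; congr (_ + _); apply: eq_bigr => y _;
    by rewrite noise_weightS mulrA.
rewrite {1}/S (sum_tupleS n (G n.+1 f g)) !E !IH.
rewrite /H (sum_tupleS n (fun w => rho ^+ count id w * dot (hat f w) (hat g w))).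
rewrite !mulr_sumr -!big_split; apply: eq_bigr => w _ /=.
rewrite add0n add1n exprS !dotZl !dotZr !dotDl !dotDr !dotZl !dotZr /fb /gb.
by field.
Qed.

Definition character (w t : seq bool) n : R :=
  \prod_(i < n) (if nth false w i then sign R (nth false t i) else 1).

Lemma hatE n f (w : seq bool) : size w = n ->
  hat f w = (2 ^+ n)^-1 *: \sum_(t : n.-tuple bool) character w t n *: f t.
Proof.
elim: n f w => [|n IH] f [|b w] //= => [_|[sw]].
  rewrite (big_tuple0 _ (fun t => character [::] t 0 *: f t)).
  by rewrite /character big_ord0 expr0 invr1 !scale1r.
rewrite (big_tupleS _ n (fun t => character (b :: w) t n.+1 *: f t)) /=.
rewrite big_bool /= addrC !(IH _ w sw).
rewrite scalerA mulrC -scalerA -scalerDr scalerA exprS invfM; congr (_ *: _).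
have cS a (t : seq bool) : character (b :: w) (a :: t) n.+1
   = (if b then sign R a else 1) * character w t n.
  by rewrite /character big_ord_recl.
rewrite scaler_sumr; congr (_ + _); apply: eq_bigr => t _; rewrite cS.
  by case: (b); rewrite /= mul1r.
by rewrite scalerA.
Qed.

End Fourier.

Section Bridge.
Variables (R : realType) (n k : nat).

Definition word_ffun (w : seq bool) : {ffun 'I_n -> bool} :=
  [ffun i : 'I_n => nth false w i].

Definition row_of (u : k.-tuple R) : 'rV[R]_k := \row_j tnth u j.

Lemma dotp_row u v : dotp u v = dot (row_of u) (row_of v).
Proof. by apply: eq_bigr => j _; rewrite !mxE. Qed.

Definition word_fun (f : {ffun 'I_n -> bool} -> k.-tuple R) (w : seq bool) :=
  row_of (f (word_ffun w)).

Lemma sum_ffun_tuple (A : zmodType) (F : {ffun 'I_n -> bool} -> A) :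
  \sum_x F x = \sum_(t : n.-tuple bool) F (word_ffun t).
Proof.
rewrite (reindex (fun t : n.-tuple bool => word_ffun t)) //.
exists (fun x : {ffun 'I_n -> bool} => [tuple x i | i < n]) => [t|x] _.
  by apply: eq_from_tnth => i; rewrite tnth_mktuple ffunE (tnth_nth false).
by apply/ffunP => i; rewrite ffunE -tnth_nth tnth_mktuple.
Qed.

Lemma sum_set_tuple (A : zmodType) (F : {set 'I_n} -> A) :
  \sum_S F S = \sum_(t : n.-tuple bool) F [set i : 'I_n | nth false t i].
Proof.
rewrite (reindex (fun t : n.-tuple bool => [set i : 'I_n | nth false t i])) //.
exists (fun S : {set 'I_n} => [tuple i \in S | i < n]) => [t|S] _.
  by apply: eq_from_tnth => i; rewrite tnth_mktuple inE (tnth_nth false).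
by apply/setP => i; rewrite inE -tnth_nth tnth_mktuple.
Qed.

Lemma card_word_set (t : n.-tuple bool) :
  #|[set i : 'I_n | nth false t i]| = count id t.
Proof.
rewrite -sum1_card -sum1_count big_tuple.
by apply: eq_bigl => i; rewrite inE (tnth_nth false).
Qed.

Lemma BStabE (rho : R) (f : {ffun 'I_n -> bool} -> k.-tuple R) :
  BStab rho f = \sum_(w : n.-tuple bool)
    rho ^+ count id w * dot (hat (word_fun f) w) (hat (word_fun f) w).
Proof.
rewrite -noise_stab_hat /BStab sum_ffun_tuple; apply: eq_bigr => x _.
rewrite sum_ffun_tuple; apply: eq_bigr => y _.
rewrite dotp_row; congr (_ * _).
rewrite natrX -exprVn -[X in _ ^+ X]card_ord -prodr_const -big_split.
apply: eq_bigr => i _ /=; rewrite !ffunE.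
have sE b : sgn R b = sign R b by [].
by rewrite !sE; field.
Qed.

Lemma fhat_hat (f : {ffun 'I_n -> bool} -> k.-tuple R) j (t : n.-tuple bool) :
  fhat (fun x => tnth (f x) j) [set i : 'I_n | nth false t i]
  = hat (word_fun f) t 0 j.
Proof.
rewrite (hatE _ (size_tuple t)) mxE /fhat natrX sum_ffun_tuple; congr (_ * _).
rewrite summxE; apply: eq_bigr => x _; rewrite !mxE mulrC; congr (_ * _).
rewrite /chi /character [LHS]big_mkcond; apply: eq_bigr => i _ /=.
by rewrite inE ffunE.
Qed.

Lemma sum_Inf_le m (i : 'I_n) (f : {ffun 'I_n -> bool} -> k.-tuple R) :
  \sum_(j < k) Inf_le m i (fun x => tnth (f x) j)
  = \sum_(t : n.-tuple bool | (count id t <= m)%N && nth false t i)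
      dot (hat (word_fun f) t) (hat (word_fun f) t).
Proof.
rewrite /Inf_le.
under eq_bigr do rewrite big_mkcond sum_set_tuple.
rewrite exchange_big [RHS]big_mkcond; apply: eq_bigr => t _ /=.
rewrite card_word_set inE; case: ifP => _; last by rewrite big1.
by apply: eq_bigr => j _; rewrite fhat_hat expr2.
Qed.

End Bridge.

(** * Iterated expectations *)

Section Measurability.
Context (d : measure_display) (T : measurableType d) (R : realType).

Lemma measurable_funV (f : T -> R) : measurable_fun setT f ->
  (forall x, 0 < f x) -> measurable_fun setT (fun x => (f x)^-1).
Proof.
move=> mf f0.
rewrite (_ : (fun x => _) = (@powR R ^~ (-1)) \o f).
  by apply: measurableT_comp => //; exact: measurable_powR.
by apply/funext => x /=; rewrite powR_inv1 // ltW.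
Qed.

Lemma measurable_fun_sumr (I : Type) (s : seq I) (f : I -> T -> R) :
  (forall i, measurable_fun setT (f i)) ->
  measurable_fun setT (fun x => \sum_(i <- s) f i x).
Proof.
move=> mf; elim: s => [|i s IH].
  by under eq_fun do rewrite big_nil; exact: measurable_cst.
under eq_fun do rewrite big_cons.
exact: measurable_funD.
Qed.

End Measurability.

(** Tonelli applies to the positive and the negative part separately, and [fine] is measurable, so
    this covers sections that are not integrable too. *)
Lemma measurable_fun_Rintegral (d d' : measure_display) (S : measurableType d')
  (T : measurableType d) (R : realType) (P : probability T R) (G : S * T -> R) :
  measurable_fun setT G ->
  measurable_fun setT (fun s => Rintegral P setT (fun x => G (s, x))).
Proof.
move=> mG; rewrite /Rintegral.
have mEG : measurable_fun setT (EFin \o G) by exact/measurable_EFinP.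
apply: (measurableT_comp (@fine_measurable R setT measurableT)).
rewrite (_ : (fun s => _) = (fun s => \int[P]_x ((EFin \o G)^\+ (s, x))
   - \int[P]_x ((EFin \o G)^\- (s, x)))%E); last first.
  apply/funext => s; rewrite integralE; congr (_ - _)%E;
    by apply: eq_integral => x _; rewrite ?funeposE ?funenegE.
apply: emeasurable_funB.
  by apply: (@measurable_fun_fubini_tonelli_F _ _ _ _ _ P) => //;
    exact: measurable_funepos.
by apply: (@measurable_fun_fubini_tonelli_F _ _ _ _ _ P) => //;
  exact: measurable_funeneg.
Qed.

Section IteratedExpectation.
Context (d : measure_display) (T : measurableType d) (R : realType)
  (P : probability T R).

(** Same recursion as [gaussE] over an arbitrary probability: with [normal_prob] it unfolds to
    [gaussE], and over pairs it integrates the two correlated vectors coordinate by coordinate. *)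
Fixpoint iE (n : nat) : (n.-tuple T -> R) -> R :=
  match n return (n.-tuple T -> R) -> R with
  | 0 => fun F => F [tuple]
  | n'.+1 => fun F =>
      Rintegral P setT (fun x : T => iE (fun t : n'.-tuple T => F (cons_tuple x t)))
  end.

Lemma eq_iE n (F G : n.-tuple T -> R) : F =1 G -> iE F = iE G.
Proof. by move=> /funext ->. Qed.

Lemma measurable_iE (d' : measure_display) (S : measurableType d') n
  (F : S -> n.-tuple T -> R) :
  measurable_fun setT (fun st : S * n.-tuple T => F st.1 st.2) ->
  measurable_fun setT (fun s => iE (F s)).
Proof.
elim: n d' S F => [|n IH] d' S F mF /=.
  apply: (measurableT_comp (g := fun s => (s, [tuple]))) mF _.
  by apply: measurable_fun_pair; [exact: measurable_id | exact: measurable_cst].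
apply: (@measurable_fun_Rintegral _ _ _ _ _ P
  (fun sx : S * T => iE (fun t => F sx.1 (cons_tuple sx.2 t)))).
apply: (IH _ _ (fun (sx : S * T) t => F sx.1 (cons_tuple sx.2 t))).
apply: (measurableT_comp (g := fun z : S * T * n.-tuple T =>
   (z.1.1, cons_tuple z.1.2 z.2))) mF _.
apply: measurable_fun_pair.
  by apply: measurableT_comp => //; exact: measurable_fst.
apply: (measurable_cons (f := fun z : S * T * n.-tuple T => z.1.2)
  (g := fun z : S * T * n.-tuple T => z.2)); last exact: measurable_snd.
by apply: measurableT_comp => //; exact: measurable_fst.
Qed.

Lemma Rintegral_prob_cst (r : R) : Rintegral P setT (fun _ => r) = r.
Proof.
have e : (P : {measure set T -> \bar R}) setT = 1%E by exact: probability_setT.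
by rewrite Rintegral_cst // e mulr1.
Qed.

Lemma iE_cst n (c : R) : iE (fun _ : n.-tuple T => c) = c.
Proof. by elim: n => //= n IH; rewrite IH Rintegral_prob_cst. Qed.

Variable W : T -> R.
Hypothesis W1 : forall x, 1 <= W x.
Hypothesis iW : P.-integrable setT (EFin \o W).

Definition prodW n (t : n.-tuple T) : R := \prod_(i < n) W (tnth t i).

Lemma prodW_ge1 n (t : n.-tuple T) : 1 <= prodW t.
Proof.
by rewrite /prodW; elim/big_ind: _ => // x y hx hy; rewrite -[1]mulr1 ler_pM.
Qed.

Lemma prodW_cons n x (t : n.-tuple T) : prodW (cons_tuple x t) = W x * prodW t.
Proof.
rewrite /prodW big_ord_recl; congr (_ * _).
by apply: eq_bigr => i _; rewrite tnthS.
Qed.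

(** Linearity and monotonicity of [iE] need integrability at every level of the iteration. A product
    majorant passes to sections, with constant C * W x, so the condition is inductive. *)
Definition tame n (F : n.-tuple T -> R) :=
  measurable_fun setT F /\ exists C, forall t, `|F t| <= C * prodW t.

Lemma tame_le n (F G : n.-tuple T -> R) : measurable_fun setT F ->
  (forall t, `|F t| <= `|G t|) -> tame G -> tame F.
Proof.
move=> mF le [_ [C hC]]; split=> //; exists C => t.
exact: le_trans (hC t).
Qed.

Lemma tame_bounded n (F : n.-tuple T -> R) (C : R) : measurable_fun setT F ->
  (forall t, `|F t| <= C) -> tame F.
Proof.
move=> mF le; split=> //; exists C => t; apply: le_trans (le t) _.
by rewrite ler_peMr ?prodW_ge1 //; exact: le_trans (le t).
Qed.

Lemma tameD n (F G : n.-tuple T -> R) : tame F -> tame G ->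
  tame (fun t => F t + G t).
Proof.
move=> [mF [C hC]] [mG [D hD]]; split; first exact: measurable_funD.
exists (C + D) => t; rewrite mulrDl.
by apply: le_trans (ler_normD _ _) _; exact: lerD.
Qed.

Lemma tameZ n a (F : n.-tuple T -> R) : tame F -> tame (fun t => a * F t).
Proof.
move=> [mF [C hC]]; split; first exact: measurable_funM.
exists (`|a| * C) => t; rewrite normrM -mulrA ler_wpM2l //.
Qed.

Lemma tame_cst n (c : R) : tame (fun _ : n.-tuple T => c).
Proof. by apply: (@tame_bounded _ _ `|c|) => //; exact: measurable_cst. Qed.

Lemma measurable_cons_tuple n (x : T) : measurable_fun setT (@cons_tuple n T x).
Proof.
apply: (measurable_cons (f := fun _ : n.-tuple T => x) (g := id)).
  exact: measurable_cst.
exact: measurable_id.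
Qed.

Lemma tame_cons n (F : n.+1.-tuple T -> R) x : tame F ->
  tame (fun t => F (cons_tuple x t)).
Proof.
move=> [mF [C hC]]; split.
  by apply: measurableT_comp => //; exact: measurable_cons_tuple.
by exists (C * W x) => t; rewrite -mulrA -prodW_cons.
Qed.

Lemma measurable_iE_cons n (F : n.+1.-tuple T -> R) : measurable_fun setT F ->
  measurable_fun setT (fun x => iE (fun t => F (cons_tuple x t))).
Proof.
move=> mF; apply: (measurable_iE (F := fun x t => F (cons_tuple x t))).
apply: (measurableT_comp (g := fun z : T * n.-tuple T => cons_tuple z.1 z.2)) mF _.
apply: (measurable_cons (f := fun z : T * n.-tuple T => z.1) (g := snd)).
  exact: measurable_fst.
exact: measurable_snd.
Qed.

Lemma integrable_dominated (f : T -> R) (C : R) : measurable_fun setT f ->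
  (forall x, `|f x| <= C * W x) -> P.-integrable setT (EFin \o f).
Proof.
move=> mf le.
have iCW : P.-integrable setT (EFin \o (fun x => C * W x)).
  by apply: eq_integrable (integrableZl measurableT C iW).
apply: le_integrable iCW => //; first exact/measurable_EFinP.
move=> x _ /=; rewrite lee_fin.
by apply: le_trans (le x) _; exact: ler_norm.
Qed.

Lemma iE_bound n (F : n.-tuple T -> R) (C : R) : measurable_fun setT F ->
  (forall t, `|F t| <= C * prodW t) ->
  `|iE F| <= C * (Rintegral P setT W) ^+ n.
Proof.
elim: n F C => [|n IH] F C mF le /=.
  by have := le [tuple]; rewrite /prodW big_ord0 expr0.
set w := Rintegral P setT W.
have b x : `|iE (fun t => F (cons_tuple x t))| <= C * w ^+ n * W x.
  rewrite mulrAC; apply: IH.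
    by apply: measurableT_comp => //; exact: measurable_cons_tuple.
  by move=> t; rewrite -mulrA -prodW_cons.
have mI := measurable_iE_cons mF.
have iI := integrable_dominated mI b.
apply: le_trans (le_normr_Rintegral measurableT iI) _.
apply: le_trans (_ : Rintegral P setT (fun x => C * w ^+ n * W x) <= _).
  apply: le_Rintegral => //.
  - exact: integrable_norm.
  - by apply: eq_integrable (integrableZl measurableT (C * w ^+ n) iW).
by rewrite RintegralZl // exprSr mulrA.
Qed.

Lemma tame_integrable n (F : n.+1.-tuple T -> R) : tame F ->
  P.-integrable setT (EFin \o (fun x => iE (fun t => F (cons_tuple x t)))).
Proof.
move=> [mF [C hC]].
apply: (@integrable_dominated _ (C * Rintegral P setT W ^+ n)).
  exact: measurable_iE_cons.
move=> x; rewrite mulrAC; apply: iE_bound.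
  by apply: measurableT_comp => //; exact: measurable_cons_tuple.
by move=> t; rewrite -mulrA -prodW_cons.
Qed.

Lemma iED n (F G : n.-tuple T -> R) : tame F -> tame G ->
  iE (fun t => F t + G t) = iE F + iE G.
Proof.
elim: n F G => [//|n IH] F G tF tG /=.
under eq_Rintegral do rewrite (IH _ _ (tame_cons _ tF) (tame_cons _ tG)).
by rewrite RintegralD //; exact: tame_integrable.
Qed.

Lemma iEZ n a (F : n.-tuple T -> R) : tame F -> iE (fun t => a * F t) = a * iE F.
Proof.
elim: n F => [//|n IH] F tF /=.
under eq_Rintegral do rewrite (IH _ (tame_cons _ tF)).
by rewrite RintegralZl //; exact: tame_integrable.
Qed.

Lemma iE_le n (F G : n.-tuple T -> R) : tame F -> tame G ->
  (forall t, F t <= G t) -> iE F <= iE G.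
Proof.
elim: n F G => [|n IH] F G tF tG le /=; first exact: le.
apply: le_Rintegral => //; [exact: tame_integrable | exact: tame_integrable |].
by move=> x _; apply: IH => //; exact: tame_cons.
Qed.

End IteratedExpectation.

(** * Lindeberg's replacement argument *)

Lemma measurable_ev (d : measure_display) (T : measurableType d) (R : realType)
    (X : T -> R) k n (c : seq bool -> 'rV[R]_k) j : measurable_fun setT X ->
  measurable_fun setT (fun t : n.-tuple T => ev c [seq X x | x <- t] 0 j).
Proof.
move=> mX; elim: n c => [|n IH] c.
  rewrite (_ : (fun t => _) = cst (c [::] 0 j)); first exact: measurable_cst.
  by apply/funext => t; rewrite tuple0.
rewrite (_ : (fun t => _) = (fun t : n.+1.-tuple T =>
    ev (c \o cons false) [seq X x | x <- [tuple of behead t]] 0 j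
    + X (tnth t ord0)
      * ev (c \o cons true) [seq X x | x <- [tuple of behead t]] 0 j)).
  have mb := @measurable_behead _ T n.
  apply: measurable_funD; first exact: (measurableT_comp (IH _) mb).
  apply: measurable_funM; last exact: (measurableT_comp (IH _) mb).
  by apply: measurableT_comp => //; exact: measurable_tnth.
by apply/funext => t; case/tupleP: t => x t; rewrite /= !mxE.
Qed.

Lemma measurable_dot (d : measure_display) (T : measurableType d) (R : realType)
    k (u v : T -> 'rV[R]_k) :
  (forall j, measurable_fun setT (fun t => u t 0 j)) ->
  (forall j, measurable_fun setT (fun t => v t 0 j)) ->
  measurable_fun setT (fun t => dot (u t) (v t)).
Proof.
by move=> mu mv; apply: measurable_fun_sumr => j; exact: measurable_funM.
Qed.

Lemma measurable_er (d : measure_display) (T : measurableType d) (R : realType)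
    r (w : T -> R) : measurable_fun setT w -> (forall x, 0 <= w x) ->
  measurable_fun setT (fun x => er r (w x)).
Proof.
move=> mw w0; apply: measurable_funV.
  by apply: measurable_fun_sumr => i; exact: measurable_funX.
by move=> x; exact: lt_le_trans (geom_sum_gt0 r (w0 x)).
Qed.

(** With u = |b|^2, the factor multiplying C |t|^3 in [er_taylor]. *)
Definition kap (R : realFieldType) (l u : R) : R := l * u + l^-1 * u ^+ 2.

Lemma kap_le (R : realFieldType) (l u v : R) : 0 < l -> 0 <= u -> u <= v ->
  kap l u <= kap l v.
Proof.
move=> l0 u0 uv; have v0 := le_trans u0 uv.
by rewrite /kap lerD // ler_wpM2l ?invr_ge0 ?lerXn2r ?nnegrE // ltW.
Qed.

Section StandardVariable.
Context (d : measure_display) (T : measurableType d) (R : realType)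
  (P : probability T R).
Variable W : T -> R.
Hypothesis W1 : forall x, 1 <= W x.
Hypothesis iW : P.-integrable setT (EFin \o W).
Local Notation I f := (Rintegral P setT f).

Lemma integrable_bounded_prob (f : T -> R) (C : R) : measurable_fun setT f ->
  (forall x, `|f x| <= C) -> P.-integrable setT (EFin \o f).
Proof.
move=> mf le; apply: (integrable_dominated iW (C := C)) => // x.
apply: le_trans (le x) _; rewrite ler_peMr //; exact: le_trans (le x).
Qed.

Lemma integrable_EFinD (f g : T -> R) : P.-integrable setT (EFin \o f) ->
  P.-integrable setT (EFin \o g) -> P.-integrable setT (EFin \o (fun x => f x + g x)).
Proof. by move=> hf hg; apply: eq_integrable (integrableD measurableT hf hg). Qed.

Lemma integrable_EFinZ (a : R) (f : T -> R) : P.-integrable setT (EFin \o f) ->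
  P.-integrable setT (EFin \o (fun x => a * f x)).
Proof. by move=> hf; apply: eq_integrable (integrableZl measurableT a hf). Qed.

Lemma integrable_bE n (F : T -> seq R -> R) :
  (forall y, P.-integrable setT (EFin \o F ^~ y)) ->
  P.-integrable setT (EFin \o (fun x => bE n (F x))).
Proof.
elim: n F => [|n IH] F iF.
  by under eq_fun do rewrite /= bE0; exact: iF.
have i1 := IH (fun x y => F x (1 :: y)) (fun y => iF (1 :: y)).
have i2 := IH (fun x y => F x (-1 :: y)) (fun y => iF (-1 :: y)).
apply: eq_integrable (integrable_EFinZ 2^-1 (integrable_EFinD i1 i2)) => // x _ /=.
by rewrite bES mulrC.
Qed.

Lemma Rintegral_bE n (F : T -> seq R -> R) :
  (forall y, P.-integrable setT (EFin \o F ^~ y)) ->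
  I (fun x => bE n (F x)) = bE n (fun y => I (F ^~ y)).
Proof.
elim: n F => [|n IH] F iF.
  by rewrite bE0; apply: eq_Rintegral => x _; rewrite bE0.
have iF1 y := iF (1 :: y); have iF2 y := iF (-1 :: y).
have i1 := @integrable_bE n (fun x y => F x (1 :: y)) iF1.
have i2 := @integrable_bE n (fun x y => F x (-1 :: y)) iF2.
rewrite bES /comp -(IH _ iF1) -(IH _ iF2) -RintegralD // -RintegralZr //.
  by apply: eq_Rintegral => x _; rewrite bES.
exact: integrable_EFinD.
Qed.

(** The pointwise bound gives a finite fourth moment; a common [W] lets two variables on one space
    be dominated together. *)
Definition std_rv (X : T -> R) := [/\ measurable_fun setT X,
  forall x, (1 + X x ^+ 2) ^+ 2 <= W x, I X = 0 & I (fun x => X x ^+ 2) = 1].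

Section OneVariable.
Variable X : T -> R.
Hypothesis sX : std_rv X.

Definition m4 := I (fun x => X x ^+ 4).

Let mX : measurable_fun setT X. Proof. by case: sX. Qed.

Lemma integrable_X1 : P.-integrable setT (EFin \o X).
Proof.
case: sX => _ h _ _; apply: (integrable_dominated iW (C := 1)) => // x.
rewrite mul1r; apply: le_trans (h x); rewrite ler_norml.
by have := sqr_ge0 (1 - X x); have := sqr_ge0 (1 + X x);
  have := sqr_ge0 (X x ^+ 2); move=> *; apply/andP; split; nra.
Qed.

Lemma integrable_X2 : P.-integrable setT (EFin \o (fun x => X x ^+ 2)).
Proof.
case: sX => _ h _ _; apply: (integrable_dominated iW (C := 1)) => //.
  exact: measurable_funX.
move=> x; rewrite mul1r; apply: le_trans (h x); rewrite ger0_norm ?sqr_ge0 //.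
by have := sqr_ge0 (X x); have := sqr_ge0 (X x ^+ 2); nra.
Qed.

Lemma integrable_X4 : P.-integrable setT (EFin \o (fun x => X x ^+ 4)).
Proof.
case: sX => _ h _ _; apply: (integrable_dominated iW (C := 1)) => //.
  exact: measurable_funX.
move=> x; rewrite mul1r; apply: le_trans (h x).
rewrite ger0_norm ?exprn_even_ge0 //.
by have := sqr_ge0 (X x); rewrite (_ : 4 = 2 * 2)%N // exprM; nra.
Qed.

Lemma m4_ge0 : 0 <= m4.
Proof. by apply: Rintegral_ge0 => x _; rewrite exprn_even_ge0. Qed.

(** No cubic coefficient, because [std_rv] does not fix E X^3; cubic terms are absorbed into the
    second and fourth powers. *)
Definition pol (a0 a1 a2 a4 : R) (x : T) : R :=
  a0 + a1 * X x + a2 * X x ^+ 2 + a4 * X x ^+ 4.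

Lemma integrable_pol a0 a1 a2 a4 : P.-integrable setT (EFin \o pol a0 a1 a2 a4).
Proof.
have i0 : P.-integrable setT (EFin \o (fun _ : T => a0)).
  by apply: (@integrable_bounded_prob _ `|a0|) => //; exact: measurable_cst.
have i1 := integrable_EFinZ a1 integrable_X1.
have i2 := integrable_EFinZ a2 integrable_X2.
have i4 := integrable_EFinZ a4 integrable_X4.
exact: integrable_EFinD (integrable_EFinD (integrable_EFinD i0 i1) i2) i4.
Qed.

Lemma Rintegral_pol a0 a1 a2 a4 : I (pol a0 a1 a2 a4) = a0 + a2 + a4 * m4.
Proof.
have i0 : P.-integrable setT (EFin \o (fun _ : T => a0)).
  by apply: (@integrable_bounded_prob _ `|a0|) => //; exact: measurable_cst.
have i1 := integrable_EFinZ a1 integrable_X1.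
have i2 := integrable_EFinZ a2 integrable_X2.
have i4 := integrable_EFinZ a4 integrable_X4.
have i01 := integrable_EFinD i0 i1; have i012 := integrable_EFinD i01 i2.
rewrite /pol !RintegralD // !RintegralZl //;
  [|exact: integrable_X4|exact: integrable_X2|exact: integrable_X1].
rewrite Rintegral_prob_cst /m4.
by case: sX => _ _ -> ->; rewrite mulr0 addr0 mulr1.
Qed.

Lemma Rintegral_abs_le (f : T -> R) a0 a1 a2 a4 : measurable_fun setT f ->
  (forall x, `|f x| <= pol a0 a1 a2 a4 x) -> `|I f| <= a0 + a2 + a4 * m4.
Proof.
move=> mf le.
have i_f : P.-integrable setT (EFin \o f).
  apply: le_integrable (integrable_pol a0 a1 a2 a4) => //.
    exact/measurable_EFinP.
  move=> x _ /=; rewrite lee_fin; apply: le_trans (le x) _; exact: ler_norm.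
apply: le_trans (le_normr_Rintegral measurableT i_f) _.
rewrite -(Rintegral_pol a0 a1); apply: le_Rintegral => //.
  exact: integrable_norm.
exact: integrable_pol.
Qed.

(** The quadratic part has mean g0 + g2 both under X and under a uniform sign. The cubic errors cost
    1 + [m4] for X, by |t|^3 <= 1 + t^4, and 1 for the sign. *)
Lemma er_swap (r : nat) : exists2 C : R, 0 <= C &
  forall k (a b : 'rV[R]_k) (l : R), 0 < l ->
    `|I (fun x => er r (dot (a + X x *: b) (a + X x *: b)))
      - (er r (dot (a + b) (a + b)) + er r (dot (a - b) (a - b))) / 2|
    <= C * kap l (dot b b).
Proof.
have [C C0 H] := er_taylor R r.
have m0 := m4_ge0.
exists (C * (2 + m4)); first by rewrite mulr_ge0 //; lra.
move=> k a b l l0; have [g0 [g1 [g2 h]]] := H _ a b _ l0.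
set E := C * (l * dot b b + l^-1 * dot b b ^+ 2) in h.
have E0 : 0 <= E.
  by rewrite /E mulr_ge0 // addr_ge0 // mulr_ge0 ?dot_ge0 ?sqr_ge0 ?invr_ge0 // ltW.
pose f x := er r (dot (a + X x *: b) (a + X x *: b)).
have mf : measurable_fun setT f.
  apply: measurable_er => [|x]; last exact: dot_ge0.
  have mc j : measurable_fun setT (fun x => (a + X x *: b) 0 j).
    rewrite (_ : (fun x => _) = (fun x => a 0 j + X x * b 0 j)).
      by apply: measurable_funD => //; apply: measurable_funM.
    by apply/funext => x; rewrite !mxE.
  exact: measurable_dot.
have i_f : P.-integrable setT (EFin \o f).
  apply: (@integrable_bounded_prob _ 1) => // x.
  by have /andP[? ?] := er_bounds r (dot_ge0 (a + X x *: b)); rewrite ger0_norm.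
have bf : `|I f - (g0 + g2)| <= E * (1 + m4).
  have -> : g0 + g2 = I (pol g0 g1 g2 0) by rewrite Rintegral_pol mul0r addr0.
  rewrite -RintegralB //; last exact: integrable_pol.
  have -> : E * (1 + m4) = E + 0 + E * m4 by ring.
  apply: (@Rintegral_abs_le _ _ 0).
    apply: measurable_funB => //.
    exact/measurable_EFinP/(measurable_int P)/integrable_pol.
  move=> x; rewrite mul0r addr0.
  apply: le_trans (h (X x)) _.
  have -> : pol E 0 0 E x = E * (1 + X x ^+ 4) by rewrite /pol; ring.
  rewrite ler_wpM2l //.
  have := normr_ge0 (X x); rewrite -[X x ^+ 4]ger0_norm ?exprn_even_ge0 // normrX.
  move: `|X x| => y y0; have [y1|y1] := leP y 1.
    by apply: le_trans (_ : 1 <= _); rewrite ?exprn_ile1 ?lerDl ?exprn_ge0.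
  apply: le_trans (_ : y ^+ 4 <= _); first by rewrite ler_weXn2l // ltW.
  by rewrite lerDr.
have h1 := h 1; have h2 := h (-1).
rewrite scale1r normr1 expr1n mulr1 in h1.
rewrite scaleN1r normrN normr1 expr1n mulr1 in h2.
set A := er r (dot (a + b) (a + b)) in h1 *.
set B := er r (dot (a - b) (a - b)) in h2 *.
rewrite -/f.
have -> : C * (2 + m4) * kap l (dot b b) = E * (1 + m4) + E.
  by rewrite /E /kap; ring.
have -> : I f - (A + B) / 2 = (I f - (g0 + g2))
   + - ((A - quad g0 g1 g2 1) / 2 + (B - quad g0 g1 g2 (-1)) / 2).
  by rewrite /quad; field.
apply: le_trans (ler_normD _ _) _; rewrite lerD // normrN.
apply: le_trans (ler_normD _ _) _.
by rewrite !normrM [`|2^-1|]ger0_norm ?invr_ge0 //; lra.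
Qed.

(** The 4 serves [bE_hypercontract] and the cross term 8 N0 N1 of [kap_step]; 3 * [m4] pays for its
    quartic term. *)
Definition hyperK : R := 4 + 3 * m4.

Lemma hyperK_ge4 : 4 <= hyperK.
Proof. by rewrite /hyperK lerDl mulr_ge0 // m4_ge0. Qed.

(** Certifies that the mean of [e] is at most [v] through a polynomial majorant, so no measurability
    of [e] is involved and certificates add up. *)
Definition pol_dominated (e : T -> R) (v : R) := exists a0 a1 a2 a4,
  (forall x, e x <= pol a0 a1 a2 a4 x) /\ a0 + a2 + a4 * m4 <= v.

Lemma pol_dominated_sum n (e : 'I_n -> T -> R) (v : 'I_n -> R) :
  (forall i, pol_dominated (e i) (v i)) ->
  pol_dominated (fun x => \sum_i e i x) (\sum_i v i).
Proof.
elim: n e v => [|n IH] e v H.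
  exists 0, 0, 0, 0; split => [x|]; rewrite big_ord0 ?mul0r ?addr0 //.
  by rewrite /pol !mul0r !addr0.
have [a0 [a1 [a2 [a4 [h1 h2]]]]] := H ord0.
have [b0 [b1 [b2 [b4 [k1 k2]]]]] := IH _ _ (fun i => H (lift ord0 i)).
exists (a0 + b0), (a1 + b1), (a2 + b2), (a4 + b4); split => [x|].
  rewrite big_ord_recl; apply: le_trans (lerD (h1 x) (k1 x)) _.
  by rewrite le_eqVlt; apply/orP; left; apply/eqP; rewrite /pol; ring.
rewrite big_ord_recl; apply: le_trans _ (lerD h2 k2).
by rewrite le_eqVlt; apply/orP; left; apply/eqP; ring.
Qed.

(* One step of (2,4)-hypercontractivity: the coefficient norm absorbs the
   factor [hyperK] at each letter of a word. *)
Lemma kap_step l N0 N1 B : 0 < l -> 0 <= N0 -> 0 <= N1 -> B ^+ 2 <= N0 * N1 ->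
  pol_dominated (fun x => kap l (N0 + 2 * X x * B + X x ^+ 2 * N1))
    (kap l (N0 + hyperK * N1)).
Proof.
move=> l0 h0 h1 hB.
have li : 0 < l^-1 by rewrite invr_gt0.
(* Expand the square of N0 + 2 y B + y^2 N1 and bound its cubic term 4 y^3 B N1 by 2 (y B)^2 + 2
   (y^2 N1)^2; with B^2 <= N0 N1 the last two coefficients become 8 N0 N1 and 3 N1^2. *)
exists (l * N0 + l^-1 * N0 ^+ 2), (2 * l * B + 4 * l^-1 * N0 * B),
  (l * N1 + 8 * l^-1 * N0 * N1), (3 * l^-1 * N1 ^+ 2); split => [x|].
  rewrite /kap /pol; set y := X x.
  have -> : l * N0 + l^-1 * N0 ^+ 2 + (2 * l * B + 4 * l^-1 * N0 * B) * y
     + (l * N1 + 8 * l^-1 * N0 * N1) * y ^+ 2 + 3 * l^-1 * N1 ^+ 2 * y ^+ 4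
    = l * (N0 + 2 * y * B + y ^+ 2 * N1)
      + l^-1 * (N0 ^+ 2 + 4 * N0 * B * y + 8 * N0 * N1 * y ^+ 2 + 3 * N1 ^+ 2 * y ^+ 4).
    by ring.
  rewrite lerD2l ler_pM2l //.
  have hB2 : 0 <= 6 * y ^+ 2 * (N0 * N1 - B ^+ 2).
    by apply: mulr_ge0; [rewrite mulr_ge0 ?sqr_ge0 | rewrite subr_ge0].
  have hsq := sqr_ge0 (y * B - y ^+ 2 * N1).
  rewrite -subr_ge0 (_ : _ - _ = 6 * y ^+ 2 * (N0 * N1 - B ^+ 2)
      + 2 * (y * B - y ^+ 2 * N1) ^+ 2); last by ring.
  by rewrite addr_ge0 // mulr_ge0.
have m0 := m4_ge0.
rewrite /kap -subr_ge0.
have -> : l * (N0 + hyperK * N1) + l^-1 * (N0 + hyperK * N1) ^+ 2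
   - (l * N0 + l^-1 * N0 ^+ 2 + (l * N1 + 8 * l^-1 * N0 * N1)
      + 3 * l^-1 * N1 ^+ 2 * m4)
  = l * (hyperK - 1) * N1 + l^-1 * (2 * (hyperK - 4) * (N0 * N1)
     + (hyperK ^+ 2 - 3 * m4) * N1 ^+ 2) by ring.
have K1 : 0 <= hyperK - 1 by have := hyperK_ge4; lra.
have K5 : 0 <= hyperK - 4 by have := hyperK_ge4; lra.
have K2 : 0 <= hyperK ^+ 2 - 3 * m4 by rewrite /hyperK; nra.
apply: addr_ge0; first by rewrite !mulr_ge0 // ltW.
apply: mulr_ge0; first exact: ltW.
by rewrite addr_ge0 // !mulr_ge0 // ?sqr_ge0.
Qed.

(** Positivity of N0 x^2 - 2 x B + N1 gives N0 + 2 x B + x^2 N1 <= (N0 + N1)(1 + x^2), and the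
    square of 1 + x^2 is at most W. This makes |p|^2 [tame]. *)
Lemma dot_ev_sqr_le k n (c : seq bool -> 'rV[R]_k) (t : n.-tuple T) :
  let u := ev c [seq X x | x <- t] in
  dot u u ^+ 2 <= wN 1 n c ^+ 2 * prodW W t.
Proof.
elim: n c t => [|n IH] c t /=.
  by rewrite tuple0 /= wN0 /prodW big_ord0 mulr1.
case/tupleP: t => x t; rewrite prodW_cons [map _ _]/= ev_cons.
apply: le_trans (IH _ t) _.
set c0 := c \o cons false; set c1 := c \o cons true.
have [B [hB E]] := wN_quad n c0 c1 ler01.
rewrite (E (X x)) wNS -/c0 -/c1 mul1r.
have p0 := wN_ge0 n c0 ler01; have p1 := wN_ge0 n c1 ler01.
rewrite mulrA ler_wpM2r //; first by apply: le_trans (prodW_ge1 W1 t).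
case: sX => _ h _ _.
apply: le_trans (_ : ((wN 1 n c0 + wN 1 n c1) * (1 + X x ^+ 2)) ^+ 2 <= _).
  have q0 : 0 <= wN 1 n c0 + 2 * X x * B + X x ^+ 2 * wN 1 n c1.
    by rewrite -E wN_ge0.
  rewrite lerXn2r ?nnegrE //.
    by rewrite mulr_ge0 ?addr_ge0 ?sqr_ge0.
  rewrite -subr_ge0.
  have [hB0|B0] := boolP (wN 1 n c1 == 0).
    move: hB; rewrite (eqP hB0) mulr0 exprn_even_le0 //= => /eqP ->.
    rewrite (_ : _ - _ = wN 1 n c0 * X x ^+ 2); last by ring.
    by rewrite mulr_ge0 ?sqr_ge0.
  have p1' : 0 < wN 1 n c1 by rewrite lt_neqAle eq_sym B0.
  rewrite -(pmulr_rge0 _ p1').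
  rewrite (_ : _ * _ = X x ^+ 2 * (wN 1 n c0 * wN 1 n c1 - B ^+ 2)
    + (wN 1 n c1 - X x * B) ^+ 2); last by ring.
  by rewrite addr_ge0 ?sqr_ge0 // mulr_ge0 ?sqr_ge0 // subr_ge0.
by rewrite exprMn ler_wpM2l ?sqr_ge0.
Qed.

Lemma measurable_dot_ev k n (c : seq bool -> 'rV[R]_k) : measurable_fun setT
  (fun t : n.-tuple T => dot (ev c [seq X x | x <- t]) (ev c [seq X x | x <- t])).
Proof. by apply: measurable_dot => j; exact: measurable_ev. Qed.

Lemma measurable_er_ev r k n (c : seq bool -> 'rV[R]_k) : measurable_fun setT
  (fun t : n.-tuple T =>
     er r (dot (ev c [seq X x | x <- t]) (ev c [seq X x | x <- t]))).
Proof. by apply: measurable_er => [|t]; [exact: measurable_dot_ev | exact: dot_ge0]. Qed.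

Lemma tame_er_ev r k n (c : seq bool -> 'rV[R]_k) :
  tame W (fun t : n.-tuple T =>
     er r (dot (ev c [seq X x | x <- t]) (ev c [seq X x | x <- t]))).
Proof.
apply: (tame_bounded W1 (C := 1)); first exact: measurable_er_ev.
by move=> t; have /andP[? ?] := er_bounds r (dot_ge0 (ev c [seq X x | x <- t]));
  rewrite ger0_norm.
Qed.

Lemma tame_dot_ev k n (c : seq bool -> 'rV[R]_k) :
  tame W (fun t : n.-tuple T =>
    dot (ev c [seq X x | x <- t]) (ev c [seq X x | x <- t])).
Proof.
split; first exact: measurable_dot_ev.
exists (1 + wN 1 n c ^+ 2) => t.
have := dot_ev_sqr_le c t; rewrite ger0_norm ?dot_ge0 //=.
move: (dot _ _) => y; rewrite mulrDl mul1r.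
by have := prodW_ge1 W1 t; have := sqr_ge0 (y - 1); have := sqr_ge0 y; nra.
Qed.

(** Induction on n: conditionally on the first variable the others are replaced by the induction
    hypothesis, then the first one by [er_swap]. *)
Theorem lindeberg r : exists2 C : R, 0 <= C &
  forall k n (c : seq bool -> 'rV[R]_k) (l : R), 0 < l ->
  `| iE P (fun t : n.-tuple T =>
        er r (dot (ev c [seq X x | x <- t]) (ev c [seq X x | x <- t])))
     - bE n (fun y => er r (dot (ev c y) (ev c y)))|
  <= C * \sum_(i < n) kap l (wN hyperK n (restr i c)).
Proof.
have [C C0 H] := er_swap r; exists C => // k n c l l0.
pose Phi (u : 'rV[R]_k) := er r (dot u u).
have bPhi u : `|Phi u| <= 1.
  by have /andP[? ?] := er_bounds r (dot_ge0 u); rewrite ger0_norm.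
have K0 : 0 <= hyperK by have := hyperK_ge4; lra.
elim: n c => [|n IH] c.
  by rewrite big_ord0 mulr0 /= bE0 subrr normr0.
pose c0 := c \o cons false; pose c1 := c \o cons true.
pose cx a := fun w => c (false :: w) + a *: c (true :: w).
pose G x := iE P (fun t : n.-tuple T => Phi (ev (cx (X x)) [seq X x | x <- t])).
(* The hybrid: the first variable still follows X, all the others are signs. *)
pose Hb x := bE n (fun y => Phi (ev c0 y + X x *: ev c1 y)).
have GE : iE P (fun t : n.+1.-tuple T => Phi (ev c [seq X x | x <- t])) = I G.
  rewrite /=; apply: eq_Rintegral => x _; apply: eq_iE => t /=.
  by rewrite -ev_lin.
have mPhi u v : measurable_fun setT (fun x => Phi (u + X x *: v)).
  apply: measurable_er => [|x]; last exact: dot_ge0.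
  have mc j : measurable_fun setT (fun x => (u + X x *: v) 0 j).
    rewrite (_ : (fun x => _) = (fun x => u 0 j + X x * v 0 j)).
      by apply: measurable_funD => //; apply: measurable_funM.
    by apply/funext => x; rewrite !mxE.
  exact: measurable_dot.
have iPhi u v : P.-integrable setT (EFin \o (fun x => Phi (u + X x *: v))).
  by apply: (@integrable_bounded_prob _ 1) => // x; exact: bPhi.
have iG : P.-integrable setT (EFin \o G).
  have := tame_integrable iW (@tame_er_ev r k n.+1 c).
  apply: eq_integrable => // x _ /=; congr (_%:E); apply: eq_iE => t /=.
  by rewrite -ev_lin.
have iH : P.-integrable setT (EFin \o Hb).
  exact: (@integrable_bE n (fun x y => Phi (ev c0 y + X x *: ev c1 y))).
have HbE : I Hb = bE n (fun y => I (fun x => Phi (ev c0 y + X x *: ev c1 y))).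
  exact: (@Rintegral_bE n (fun x y => Phi (ev c0 y + X x *: ev c1 y))).
(* The inductive error depends on X x through [cx]. Integrating it with [kap_step] restores the
   coefficient norms of [c] itself, so the constant C does not grow with n. *)
have step1 : `|I G - I Hb|
    <= C * \sum_(i < n) kap l (wN hyperK n.+1 (restr i.+1 c)).
  have [a0 [a1 [a2 [a4 [h1 h2]]]]] : pol_dominated
      (fun x => \sum_(i < n) kap l (wN hyperK n (restr i (cx (X x)))))
      (\sum_(i < n) kap l (wN hyperK n.+1 (restr i.+1 c))).
    apply: pol_dominated_sum => i; rewrite inflS.
    have [B [hB E]] := wN_quad n (restr i c0) (restr i c1) K0.
    have [b0 [b1 [b2 [b4 [k1 k2]]]]] := kap_step l0 (wN_ge0 n (restr i c0) K0)
      (wN_ge0 n (restr i c1) K0) hB.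
    exists b0, b1, b2, b4; split=> // x.
    by rewrite (eq_wN _ _ (restr_lin i c0 c1 (X x))) E.
  rewrite -RintegralB //.
  apply: le_trans (_ : C * a0 + C * a2 + C * a4 * m4 <= _); last first.
    by rewrite -mulrA -!mulrDr ler_wpM2l.
  apply: (@Rintegral_abs_le _ _ (C * a1)).
    by apply: measurable_funB; exact/measurable_EFinP/(measurable_int P).
  move=> x.
  have -> : pol (C * a0) (C * a1) (C * a2) (C * a4) x = C * pol a0 a1 a2 a4 x.
    by rewrite /pol; ring.
  apply: le_trans (ler_wpM2l C0 (h1 x)); apply: le_trans (IH (cx (X x))).
  rewrite le_eqVlt; apply/orP; left; apply/eqP; congr `|_ - _|.
  by apply: eq_bE => w _; rewrite /Phi /cx (ev_lin c0 c1).
have step2 : `|I Hb - bE n.+1 (fun y => Phi (ev c y))|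
    <= C * kap l (wN hyperK n.+1 (restr 0 c)).
  rewrite HbE bES /comp -bED mulrC -bEZ -bEB.
  apply: le_trans (ler_norm_bE _ _) _.
  apply: le_trans (_ : bE n (fun y => C * kap l (dot (ev c1 y) (ev c1 y))) <= _).
    apply: le_bE => w _ /=; rewrite -/c0 -/c1 scale1r scaleN1r mulrC.
    exact: H.
  (* The mean of [kap] splits into a second moment, given by Parseval, and a fourth moment, given by
     hypercontractivity on the cube. *)
  rewrite bEZ ler_wpM2l // /kap bED !bEZ bE_sqr infl0 -/c1.
  have w1 : wN 1 n c1 <= wN hyperK n c1.
    apply: ler_sum => t _; rewrite ler_wpM2r ?dot_ge0 // expr1n exprn_ege1 //.
    by have := hyperK_ge4; lra.
  have wK : wN hyperK n c1 <= hyperK * wN hyperK n c1.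
    by rewrite ler_peMl ?wN_ge0 //; have := hyperK_ge4; lra.
  have w0 := wN_ge0 n c1 K0.
  apply: le_trans (kap_le l0 w0 wK); rewrite /kap lerD //.
    by rewrite ler_wpM2l // ltW.
  by rewrite ler_wpM2l ?invr_ge0 ?(ltW l0) // bE_hypercontract ?hyperK_ge4.
rewrite GE big_ord_recl mulrDr.
rewrite (_ : _ - _ = (I Hb - bE n.+1 (fun y => Phi (ev c y))) + (I G - I Hb));
  last by rewrite /Phi; ring.
by apply: le_trans (ler_normD _ _) _; exact: lerD.
Qed.

End OneVariable.

(** The Gaussian stability of a multilinear polynomial is thus exactly the Boolean formula; X = Y
    with correlation 1 gives its second moment. *)
Lemma iE_dot_ev (X Y : T -> R) (rho : R) k n (a b : seq bool -> 'rV[R]_k) :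
  std_rv X -> std_rv Y -> I (fun x => X x * Y x) = rho ->
  iE P (fun t : n.-tuple T => dot (ev a [seq X x | x <- t]) (ev b [seq Y x | x <- t]))
  = \sum_(w : n.-tuple bool) rho ^+ count id w * dot (a w) (b w).
Proof.
move=> sX sY XY.
pose S n (a b : seq bool -> 'rV[R]_k) :=
  \sum_(w : n.-tuple bool) rho ^+ count id w * dot (a w) (b w).
rewrite -/(S n a b).
elim: n a b => [|n IH] a b.
  rewrite /= /S (sum_tuple0 (fun w => rho ^+ count id w * dot (a w) (b w))).
  by rewrite expr0 mul1r.
pose a0 := a \o cons false; pose a1 := a \o cons true.
pose b0 := b \o cons false; pose b1 := b \o cons true.
have E x : iE P (fun t : n.-tuple T =>
     dot (ev a [seq X x | x <- cons_tuple x t]) (ev b [seq Y x | x <- cons_tuple x t]))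
  = S n a0 b0 + S n a0 b1 * Y x + S n a1 b0 * X x + S n a1 b1 * (X x * Y x).
  rewrite (_ : iE _ _ = S n (fun w => a (false :: w) + X x *: a (true :: w))
      (fun w => b (false :: w) + Y x *: b (true :: w))); last first.
    by rewrite -IH; apply: eq_iE => t; rewrite [map _ _]/= [map Y _]/= !ev_cons.
  rewrite /S !mulr_suml -!big_split; apply: eq_bigr => w _ /=.
  by rewrite !dotDl !dotDr !dotZl !dotZr /a0 /a1 /b0 /b1 /=; ring.
rewrite /=; under eq_Rintegral do rewrite E.
have iX := integrable_X1 sX; have iY := integrable_X1 sY.
have iXY : P.-integrable setT (EFin \o (fun x => X x * Y x)).
  case: sX sY => mX hX _ _ [mY hY _ _].
  apply: (integrable_dominated iW (C := 1)) => [|x].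
    exact: measurable_funM.
  rewrite mul1r ler_norml.
  have := hX x; have := hY x; have := W1 x; move: (W x) (X x) (Y x) => w x' y.
  have := sqr_ge0 (x' - y); have := sqr_ge0 (x' + y).
  have := sqr_ge0 (x' ^+ 2); have := sqr_ge0 (y ^+ 2).
  by move=> *; apply/andP; split; nra.
have i0 : P.-integrable setT (EFin \o (fun _ : T => S n a0 b0)).
  by apply: (@integrable_bounded_prob _ `|S n a0 b0|) => //; exact: measurable_cst.
have j1 := integrable_EFinZ (S n a0 b1) iY.
have j2 := integrable_EFinZ (S n a1 b0) iX.
have j3 := integrable_EFinZ (S n a1 b1) iXY.
have k1 := integrable_EFinD i0 j1; have k2 := integrable_EFinD k1 j2.
rewrite !RintegralD // !RintegralZl // XY Rintegral_prob_cst.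
case: sX => _ _ -> _; case: sY => _ _ -> _.
rewrite !mulr0 !addr0 /S (sum_tupleS n (fun w => rho ^+ count id w * dot (a w) (b w))).
congr (_ + _); rewrite mulr_suml; apply: eq_bigr => w _ /=.
by rewrite exprS; ring.
Qed.

End StandardVariable.

(** * Moments of the standard normal distribution *)

Section GaussianMoments.
Variable R : realType.
Local Notation mu := (@lebesgue_measure R).
Local Notation gam := (normal_prob (0 : R) 1).

(** The Radon-Nikodym derivative agrees with the density almost everywhere, since both have the same
    integral over every measurable set. *)
Lemma integral_normal_prob (g : R -> \bar R) : measurable_fun setT g ->
  (forall x, 0 <= g x)%E ->
  (\int[gam]_x g x = \int[mu]_x (g x * (normal_pdf 0 1 x)%:E))%E.
Proof.
move=> mg g0; have dom := @normal_prob_dominates R 0 1.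
rewrite -(Radon_Nikodym_SigmaFinite.change_of_variables dom) //.
apply: ae_eq_integral => //.
- apply: emeasurable_funM => //; apply: (measurable_int mu).
  exact: Radon_Nikodym_SigmaFinite.f_integrable.
- apply: emeasurable_funM => //; apply/measurable_EFinP.
  exact: measurable_normal_pdf.
- apply: ae_eqe_mul2l; apply: integral_ae_eq => //.
  + exact: Radon_Nikodym_SigmaFinite.f_integrable.
  + by apply/measurable_EFinP; exact: measurable_normal_pdf.
  + by move=> E _ mE; rewrite -Radon_Nikodym_SigmaFinite.f_integral.
Qed.

(** Tilting by [g] yields C times another normal density, whose total mass is 1, so no integral has
    to be computed. *)
Lemma integral_normal_tilt (g : R -> R) (C m s : R) : measurable_fun setT g ->
  (forall x, 0 <= g x) -> 0 <= C ->
  (forall x, g x * normal_pdf 0 1 x = C * normal_pdf m s x) ->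
  (\int[gam]_x (g x)%:E = C%:E)%E.
Proof.
move=> mg g0 C0 E.
rewrite integral_normal_prob; [|exact/measurable_EFinP|by move=> x; rewrite lee_fin].
under eq_integral do rewrite -EFinM E EFinM.
rewrite ge0_integralZl //=.
- by rewrite integral_normal_pdf mule1.
- by apply/measurable_EFinP; exact: measurable_normal_pdf.
- by move=> x _; rewrite lee_fin normal_pdf_ge0.
Qed.

Lemma integral_expR_lin (a : R) :
  (\int[gam]_x (expR (a * x))%:E = (expR (a ^+ 2 / 2))%:E)%E.
Proof.
apply: (@integral_normal_tilt _ _ a 1).
- by apply: measurableT_comp => //; exact: measurable_funM.
- by move=> x; exact: expR_ge0.
- exact: expR_ge0.
move=> x; rewrite !normal_pdfE ?oner_neq0 // /normal_fun.
rewrite mulrCA [RHS]mulrCA -!expRD; congr (_ * expR _).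
by rewrite expr1n; field.
Qed.

Lemma integral_expR_sqr (c : R) : 0 < c ->
  (\int[gam]_x (expR ((1 - c ^+ 2) / 2 * x ^+ 2))%:E = (c^-1)%:E)%E.
Proof.
move=> c0; have cn : c != 0 by exact: lt0r_neq0.
apply: (@integral_normal_tilt _ _ 0 c^-1).
- apply: measurableT_comp => //; apply: measurable_funM => //.
- by move=> x; exact: expR_ge0.
- by rewrite invr_ge0 ltW.
move=> x; rewrite !normal_pdfE ?oner_neq0 ?invr_eq0 //.
rewrite /normal_fun /normal_peak.
rewrite mulrCA -expRD [RHS]mulrA; congr (_ * expR _); last first.
  by rewrite expr1n; field.
rewrite expr1n mul1r -mulrnAr sqrtrM ?sqr_ge0 // sqrtr_sqr.
by rewrite ger0_norm ?invr_ge0 ?(ltW c0) // invfM invrK mulrA mulVf // mul1r.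
Qed.

Definition gW (x : R) : R := (1 + x ^+ 2) ^+ 2.

Lemma gW_ge1 x : 1 <= gW x.
Proof. by rewrite /gW exprn_ege1 // lerDl sqr_ge0. Qed.

Lemma integrable_ge0_fin (g : R -> R) (C : R) : measurable_fun setT g ->
  (forall x, 0 <= g x) -> (\int[gam]_x (g x)%:E = C%:E)%E ->
  gam.-integrable setT (EFin \o g).
Proof.
move=> mg g0 E; apply/integrableP; split; first exact/measurable_EFinP.
under eq_integral do rewrite /= ger0_norm //.
by rewrite E ltry.
Qed.

Lemma measurable_gW : measurable_fun setT gW.
Proof. by apply: measurable_funX; apply: measurable_funD => //; exact: exprn_measurable. Qed.

Lemma integrable_gW : gam.-integrable setT (EFin \o gW).
Proof.
(* This makes the exponent x^2 / 4, and 1 + x^2 <= 8 (1 + x^2 / 8) <= 8 exp(x^2 / 8) squares to the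
   domination with constant 64. *)
pose c : R := Num.sqrt 2^-1.
have c0 : 0 < c by rewrite sqrtr_gt0 invr_gt0.
have c2 : c ^+ 2 = 2^-1 by rewrite sqr_sqrtr // invr_ge0.
have i1 : gam.-integrable setT (EFin \o (fun x => expR ((1 - c ^+ 2) / 2 * x ^+ 2))).
  apply: (integrable_ge0_fin _ _ (integral_expR_sqr c0)) => [|x]; last exact: expR_ge0.
  by apply: measurableT_comp => //; apply: measurable_funM.
have i2 := integrableZl measurableT 64 i1.
apply: le_integrable i2 => //; first by apply/measurable_EFinP; exact: measurable_gW.
move=> x _ /=; rewrite lee_fin.
rewrite ger0_norm; last by rewrite (le_trans ler01) // gW_ge1.
rewrite ger0_norm; last by rewrite mulr_ge0 ?expR_ge0.
rewrite c2 (_ : (1 - 2^-1) / 2 * x ^+ 2 = x ^+ 2 / 8 + x ^+ 2 / 8); last by field.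
rewrite expRD -expr2 (_ : 64 = 8 ^+ 2); last by ring.
rewrite -exprMn /gW lerXn2r ?nnegrE ?mulr_ge0 ?expR_ge0 ?addr_ge0 ?sqr_ge0 //.
by have := expR_ge1Dx (x ^+ 2 / 8); have := sqr_ge0 x; lra.
Qed.

(* The mean and the variance are read off the exponential moments by letting the
   parameter tend to 0 in [1 + t <= expR t]; this avoids integration by parts. *)
Lemma normal_mean : Rintegral gam setT (fun x => x) = 0.
Proof.
set m := Rintegral _ _ _.
have i1 : gam.-integrable setT (EFin \o (fun x : R => x)).
  apply: (integrable_dominated integrable_gW (C := 1)) => // x.
  rewrite mul1r /gW ler_norml.
  by have := sqr_ge0 (1 - x); have := sqr_ge0 (1 + x);
    have := sqr_ge0 (x ^+ 2); move=> *; apply/andP; split; nra.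
have key a : 1 + a * m <= expR (a ^+ 2 / 2).
  have ie : gam.-integrable setT (EFin \o (fun x => expR (a * x))).
    apply: (integrable_ge0_fin _ _ (integral_expR_lin a)) => [|x]; last exact: expR_ge0.
    by apply: measurableT_comp => //; exact: measurable_funM.
  have -> : expR (a ^+ 2 / 2) = Rintegral gam setT (fun x => expR (a * x)).
    by rewrite /Rintegral integral_expR_lin.
  have i0 : gam.-integrable setT (EFin \o (fun _ : R => 1)).
    by apply: (integrable_dominated integrable_gW (C := 1)) => // x;
      rewrite mul1r normr1 gW_ge1.
  have ia := integrable_EFinZ a i1.
  rewrite /m -(RintegralZl _ measurableT i1) -{1}(@Rintegral_prob_cst _ _ _ gam 1).
  rewrite -RintegralD //; apply: le_Rintegral => //.
    exact: integrable_EFinD.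
  by move=> x _; exact: expR_ge1Dx.
have key2 a : `|a| <= 1 -> a * m <= a ^+ 2.
  move=> ha; have := key a.
  have a1 : a ^+ 2 <= 1 by rewrite -real_normK ?num_real // exprn_ile1.
  have := expR_ge1Dx (- (a ^+ 2 / 2)); rewrite expRN.
  have := expR_gt0 (a ^+ 2 / 2); move: (expR _) => e e0 h1 h2.
  have h3 : (1 - a ^+ 2 / 2) * e <= 1 by rewrite -ler_pdivlMr // div1r.
  by have := sqr_ge0 a; nra.
(* Testing at a = t m gives t m^2 <= t^2 m^2 with 0 < t <= 1/2, hence m = 0; t is small enough for
   |a| <= 1. *)
pose t := (2 * (1 + `|m|))^-1.
have p : 0 < 2 * (1 + `|m|) by rewrite mulr_gt0 // ltr_pwDl.
have t0 : 0 < t by rewrite invr_gt0.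
have t1 : t <= 1 / 2.
  by rewrite /t invfM div1r ler_piMr ?invr_ge0 // invf_le1 ?lerDl // ltr_pwDl.
have tm : `|t * m| <= 1.
  rewrite normrM (ger0_norm (ltW t0)) /t mulrC ler_pdivrMr // mul1r.
  by have := normr_ge0 m; lra.
have := key2 _ tm; rewrite exprMn -mulrA -!expr2 => h.
have : t * (m ^+ 2 * (1 - t)) <= 0 by nra.
rewrite pmulr_rle0 // pmulr_lle0; last lra.
by rewrite exprn_even_le0 //= => /eqP.
Qed.

Lemma normal_variance : Rintegral gam setT (fun x => x ^+ 2) = 1.
Proof.
set v := Rintegral _ _ _.
have i1 : gam.-integrable setT (EFin \o (fun x : R => x ^+ 2)).
  apply: (integrable_dominated integrable_gW (C := 1)) => [|x].
    exact: exprn_measurable.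
  rewrite mul1r /gW ger0_norm ?sqr_ge0 //.
  by have := sqr_ge0 x; have := sqr_ge0 (x ^+ 2); nra.
have v0 : 0 <= v by apply: Rintegral_ge0 => x _; exact: sqr_ge0.
have key c : 0 < c -> 1 + (1 - c ^+ 2) / 2 * v <= c^-1.
  move=> c0; set a := (1 - c ^+ 2) / 2.
  have ie : gam.-integrable setT (EFin \o (fun x => expR (a * x ^+ 2))).
    apply: (integrable_ge0_fin _ _ (integral_expR_sqr c0)) => [|x]; last exact: expR_ge0.
    by apply: measurableT_comp => //; apply: measurable_funM.
  have -> : c^-1 = Rintegral gam setT (fun x => expR (a * x ^+ 2)).
    by rewrite /Rintegral integral_expR_sqr.
  have i0 : gam.-integrable setT (EFin \o (fun _ : R => 1)).
    by apply: (integrable_dominated integrable_gW (C := 1)) => // x;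
      rewrite mul1r normr1 gW_ge1.
  have ia := integrable_EFinZ a i1.
  rewrite /v -(RintegralZl _ measurableT i1) -{1}(@Rintegral_prob_cst _ _ _ gam 1).
  rewrite -RintegralD //; apply: le_Rintegral => //.
    exact: integrable_EFinD.
  by move=> x _; exact: expR_ge1Dx.
have key2 c : 0 < c -> (1 - c) * (c * (1 + c) * v) <= (1 - c) * 2.
  move=> c0; have := key c c0; rewrite -(ler_pM2r c0) mulVf ?lt0r_neq0 // => h.
  have e : (1 - c) * (c * (1 + c) * v)
      = ((1 + (1 - c ^+ 2) / 2 * v) * c) * 2 - 2 * c by field.
  by rewrite e; lra.
apply/eqP; rewrite eq_le; apply/andP; split; rewrite leNgt; apply/negP => hv.
  (* At c = 1 - e the bound reads (2 - 3e + e^2) v <= 2; since 3 e v = v - 1 this is v + 1 + e^2 v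
     <= 2, against v > 1. *)
  pose e := (v - 1) / (3 * v).
  have ev3 : e * (3 * v) = v - 1 by rewrite /e divfK // mulf_neq0 // lt0r_neq0 //; lra.
  have e0 : 0 < e by rewrite divr_gt0 //; lra.
  have e1 : e < 1 by rewrite ltr_pdivrMr; lra.
  have := key2 (1 - e) ltac:(lra).
  rewrite (_ : 1 - (1 - e) = e); last by ring.
  rewrite ler_pM2l // => h.
  have : 0 <= e ^+ 2 * v by rewrite mulr_ge0 ?sqr_ge0.
  by nra.
(* At c = 1 + e the bound reads (1 + e)(2 + e) v >= 2; with v = 1 - 4e the left side is 2 - 5e -
   11e^2 - 4e^3, less than 2. *)
pose e := (1 - v) / 4.
have := key2 (1 + e) ltac:(rewrite /e; lra).
rewrite (_ : 1 - (1 + e) = - e); last by ring.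
rewrite !mulNr lerN2 ler_pM2l => [h|]; last by rewrite /e; lra.
by rewrite /e in h; nra.
Qed.

Lemma std_rv_normal : std_rv gam gW (fun x => x).
Proof. by split; [exact: measurable_id | | exact: normal_mean | exact: normal_variance]. Qed.

End GaussianMoments.

(** * Iterated Fubini *)

Section ProductProbability.
Context (d1 d2 : measure_display) (T1 : measurableType d1) (T2 : measurableType d2)
  (R : realType) (P1 : probability T1 R) (P2 : probability T2 R).
Local Notation P := (P1 \x P2)%E.
Variables (W1 : T1 -> R) (W2 : T2 -> R).
Hypothesis W1_ge1 : forall x, 1 <= W1 x.
Hypothesis W2_ge1 : forall x, 1 <= W2 x.
Hypothesis iW1 : P1.-integrable setT (EFin \o W1).
Hypothesis iW2 : P2.-integrable setT (EFin \o W2).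

Definition prodw (z : T1 * T2) : R := W1 z.1 * W2 z.2.

Lemma prodw_ge1 z : 1 <= prodw z.
Proof. by rewrite -[1]mulr1 ler_pM. Qed.

Let mW1 : measurable_fun setT W1.
Proof. exact/measurable_EFinP/(measurable_int P1). Qed.
Let mW2 : measurable_fun setT W2.
Proof. exact/measurable_EFinP/(measurable_int P2). Qed.

Lemma measurable_prodw : measurable_fun setT prodw.
Proof.
by apply: measurable_funM; apply: measurableT_comp.
Qed.

Lemma integral_EFin_Rintegral (d : measure_display) (T : measurableType d)
    (Q : probability T R) (f : T -> R) : Q.-integrable setT (EFin \o f) ->
  (\int[Q]_x (f x)%:E)%E = (Rintegral Q setT f)%:E.
Proof. by move=> i; rewrite /Rintegral fineK //; exact: integrable_fin_num. Qed.

Lemma integrable_prodw : P.-integrable setT (EFin \o prodw).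
Proof.
apply/integrable12ltyP; first by apply/measurable_EFinP; exact: measurable_prodw.
have w0 z : 0 <= prodw z by exact: le_trans (prodw_ge1 z).
have E x : (\int[P2]_y `|(EFin \o prodw) (x, y)|)%E
    = (W1 x * Rintegral P2 setT W2)%:E.
  under eq_integral do rewrite /= ger0_norm //.
  rewrite /prodw /= -(RintegralZl _ measurableT iW2) integral_EFin_Rintegral //.
  exact: integrable_EFinZ.
under eq_integral do rewrite E.
rewrite (integral_EFin_Rintegral (f := fun x => W1 x * Rintegral P2 setT W2)) ?ltry //.
under eq_fun do rewrite mulrC.
exact: integrable_EFinZ.
Qed.

Lemma integrable_prodw_dom (F : T1 * T2 -> R) (C : R) : measurable_fun setT F ->
  (forall z, `|F z| <= C * prodw z) -> P.-integrable setT (EFin \o F).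
Proof.
move=> mF le; exact: (integrable_dominated (P := P) integrable_prodw mF le).
Qed.

Lemma integrable_section1 (F : T1 * T2 -> R) (C : R) x : measurable_fun setT F ->
  (forall z, `|F z| <= C * prodw z) -> P2.-integrable setT (EFin \o (fun y => F (x, y))).
Proof.
move=> mF le; apply: (integrable_dominated iW2 (C := C * W1 x)) => [|y].
  by apply: measurableT_comp => //; exact: pair1_measurable.
by rewrite -mulrA; exact: le (x, y).
Qed.

Lemma integrable_section2 (F : T1 * T2 -> R) (C : R) y : measurable_fun setT F ->
  (forall z, `|F z| <= C * prodw z) -> P1.-integrable setT (EFin \o (fun x => F (x, y))).
Proof.
move=> mF le; apply: (integrable_dominated iW1 (C := C * W2 y)) => [|x].
  by apply: measurableT_comp => //; exact: pair2_measurable.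
by rewrite -mulrA [W2 y * _]mulrC; exact: le (x, y).
Qed.

Lemma Rintegral_prod1 (F : T1 * T2 -> R) (C : R) : measurable_fun setT F ->
  (forall z, `|F z| <= C * prodw z) ->
  Rintegral P setT F = Rintegral P1 setT (fun x => Rintegral P2 setT (fun y => F (x, y))).
Proof.
move=> mF le; have iF := integrable_prodw_dom mF le.
rewrite {1}/Rintegral -(integral12_prod_meas1 iF) /fubini_F; congr fine.
apply: eq_integral => x _ /=.
by rewrite integral_EFin_Rintegral //; exact: integrable_section1 le.
Qed.

Lemma Rintegral_prod2 (F : T1 * T2 -> R) (C : R) : measurable_fun setT F ->
  (forall z, `|F z| <= C * prodw z) ->
  Rintegral P setT F = Rintegral P2 setT (fun y => Rintegral P1 setT (fun x => F (x, y))).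
Proof.
move=> mF le; have iF := integrable_prodw_dom mF le.
rewrite {1}/Rintegral -(integral21_prod_meas1 iF) /fubini_G; congr fine.
apply: eq_integral => x _ /=.
by rewrite integral_EFin_Rintegral //; exact: integrable_section2 le.
Qed.

End ProductProbability.

Section BoundedFubini.
Context (d1 d2 : measure_display) (T1 : measurableType d1) (T2 : measurableType d2)
  (R : realType) (P1 : probability T1 R) (P2 : probability T2 R).

Lemma integrable_one (d : measure_display) (T : measurableType d)
  (P : probability T R) : P.-integrable setT (EFin \o (fun _ : T => 1 : R)).
Proof.
apply/integrableP; split; first exact/measurable_EFinP.
under eq_integral do rewrite /= normr1.
rewrite integral_cst // mul1e.
have -> : (P : {measure set T -> \bar R}) setT = 1%E by exact: probability_setT.
exact: ltry.
Qed.

Let dom (F : T1 * T2 -> R) (C : R) (le : forall z, `|F z| <= C) z :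
  `|F z| <= C * prodw (fun=> 1) (fun=> 1) z.
Proof. by rewrite /prodw !mulr1. Qed.

Lemma Rintegral_prod_bounded (F : T1 * T2 -> R) (C : R) : measurable_fun setT F ->
  (forall z, `|F z| <= C) -> Rintegral (P1 \x P2)%E setT F
  = Rintegral P1 setT (fun x => Rintegral P2 setT (fun y => F (x, y))).
Proof.
by move=> mF le; apply: (Rintegral_prod1 _ _ (integrable_one P1)
  (integrable_one P2) mF (dom le)).
Qed.

Lemma Rintegral_swap_bounded (F : T1 * T2 -> R) (C : R) : measurable_fun setT F ->
  (forall z, `|F z| <= C) ->
  Rintegral P1 setT (fun x => Rintegral P2 setT (fun y => F (x, y)))
  = Rintegral P2 setT (fun y => Rintegral P1 setT (fun x => F (x, y))).
Proof.
move=> mF le; rewrite -(Rintegral_prod_bounded mF le).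
by apply: (Rintegral_prod2 _ _ (integrable_one P1) (integrable_one P2) mF (dom le)).
Qed.

Lemma iE_bounded n (F : n.-tuple T1 -> R) (C : R) : measurable_fun setT F ->
  (forall t, `|F t| <= C) -> `|iE P1 F| <= C.
Proof.
move=> mF le.
have := @iE_bound _ _ _ P1 (fun=> 1) (integrable_one P1) n F C mF.
rewrite Rintegral_prob_cst expr1n mulr1; apply=> t.
by rewrite /prodW big1 // mulr1.
Qed.

Lemma iE_Rintegral_swap n (G : n.-tuple T1 -> T2 -> R) (C : R) :
  measurable_fun setT (fun p : n.-tuple T1 * T2 => G p.1 p.2) ->
  (forall t z, `|G t z| <= C) ->
  iE P1 (fun t => Rintegral P2 setT (G t))
  = Rintegral P2 setT (fun z => iE P1 (fun t => G t z)).
Proof.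
elim: n G => [//|n IH] G mG le /=.
have mx x : measurable_fun setT
    (fun p : n.-tuple T1 * T2 => G (cons_tuple x p.1) p.2).
  apply: (measurableT_comp (g := fun p : n.-tuple T1 * T2 =>
    (cons_tuple x p.1, p.2))) mG _.
  apply: measurable_fun_pair; last exact: measurable_snd.
  apply: (measurable_cons (f := fun _ : n.-tuple T1 * T2 => x) (g := fst)) => //.
under eq_Rintegral => x _ do rewrite (IH _ (mx x)) //.
apply: (@Rintegral_swap_bounded (fun p => iE P1 (fun t => G (cons_tuple p.1 t) p.2)) C).
  apply: (measurable_iE P1 (F := fun (p : T1 * T2) t => G (cons_tuple p.1 t) p.2)).
  apply: (measurableT_comp (g := fun p : T1 * T2 * n.-tuple T1 =>
    (cons_tuple p.1.1 p.2, p.1.2))) mG _.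
  apply: measurable_fun_pair.
    apply: (measurable_cons (f := fun p : T1 * T2 * n.-tuple T1 => p.1.1)
      (g := snd)); last exact: measurable_snd.
    by apply: measurableT_comp => //; exact: measurable_fst.
  by apply: measurableT_comp => //; exact: measurable_fst.
move=> p; apply: iE_bounded => //.
apply: (measurableT_comp (g := fun t : n.-tuple T1 => (cons_tuple p.1 t, p.2))) mG _.
apply: measurable_fun_pair; last exact: measurable_cst.
exact: measurable_cons_tuple.
Qed.

End BoundedFubini.

Definition fst_tuple (A B : Type) n (t : n.-tuple (A * B)) : n.-tuple A :=
  [tuple of map fst t].
Definition snd_tuple (A B : Type) n (t : n.-tuple (A * B)) : n.-tuple B :=
  [tuple of map snd t].

(** [GStab] integrates over all of x and then all of z, whereas the replacement needs one pair per
    coordinate. Each step moves the first z-integral outwards past the remaining x-integrals. *)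
Lemma iE_iE_pair (d1 d2 : measure_display) (T1 : measurableType d1)
  (T2 : measurableType d2) (R : realType) (P1 : probability T1 R)
  (P2 : probability T2 R) n (H : n.-tuple T1 -> n.-tuple T2 -> R) (C : R) :
  measurable_fun setT (fun p : n.-tuple T1 * n.-tuple T2 => H p.1 p.2) ->
  (forall x z, `|H x z| <= C) ->
  iE P1 (fun x => iE P2 (H x))
  = iE (P1 \x P2)%E (fun t => H (fst_tuple t) (snd_tuple t)).
Proof.
elim: n H => [|n IH] H mH le.
  by rewrite /=; congr H; exact/val_inj.
have mHxz x z : measurable_fun setT (fun p : n.-tuple T1 * n.-tuple T2 =>
    H (cons_tuple x p.1) (cons_tuple z p.2)).
  apply: (measurableT_comp (g := fun p : n.-tuple T1 * n.-tuple T2 =>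
    (cons_tuple x p.1, cons_tuple z p.2))) mH _.
  apply: measurable_fun_pair.
    apply: (measurable_cons (f := fun _ : n.-tuple T1 * n.-tuple T2 => x)
      (g := fst)) => //; exact: measurable_fst.
  apply: (measurable_cons (f := fun _ : n.-tuple T1 * n.-tuple T2 => z)
    (g := snd)) => //; exact: measurable_snd.
have mG x : measurable_fun setT (fun p : n.-tuple T1 * T2 =>
    iE P2 (fun t => H (cons_tuple x p.1) (cons_tuple p.2 t))).
  apply: (measurable_iE P2 (F := fun (p : n.-tuple T1 * T2) t =>
    H (cons_tuple x p.1) (cons_tuple p.2 t))).
  apply: (measurableT_comp (g := fun p : n.-tuple T1 * T2 * n.-tuple T2 =>
    (cons_tuple x p.1.1, cons_tuple p.1.2 p.2))) mH _.
  apply: measurable_fun_pair.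
    apply: (measurable_cons (f := fun _ : n.-tuple T1 * T2 * n.-tuple T2 => x)
      (g := fun p => p.1.1)) => //.
    by apply: measurableT_comp => //; exact: measurable_fst.
  apply: (measurable_cons (f := fun p : n.-tuple T1 * T2 * n.-tuple T2 => p.1.2)
    (g := snd)); last exact: measurable_snd.
  by apply: measurableT_comp => //; exact: measurable_fst.
have bG x x' z : `|iE P2 (fun t => H (cons_tuple x x') (cons_tuple z t))| <= C.
  apply: iE_bounded => //.
  apply: (measurableT_comp (g := fun t : n.-tuple T2 =>
    (cons_tuple x x', cons_tuple z t))) mH _.
  apply: measurable_fun_pair; first exact: measurable_cst.
  exact: measurable_cons_tuple.
transitivity (Rintegral P1 setT (fun x => Rintegral P2 setT (fun z =>
    iE (P1 \x P2)%E (fun t : n.-tuple (T1 * T2) =>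
      H (cons_tuple x (fst_tuple t)) (cons_tuple z (snd_tuple t)))))).
  rewrite /=; apply: eq_Rintegral => x _.
  rewrite (iE_Rintegral_swap _ _ (mG x) (bG x)); apply: eq_Rintegral => z _.
  by apply: (IH (fun x' z' => H (cons_tuple x x') (cons_tuple z z'))).
pose F (p : T1 * T2) := iE (P1 \x P2)%E (fun t : n.-tuple (T1 * T2) =>
      H (cons_tuple p.1 (fst_tuple t)) (cons_tuple p.2 (snd_tuple t))).
have mfst : measurable_fun setT (@fst_tuple T1 T2 n).
  apply/measurable_fun_tnthP => i.
  rewrite (_ : _ \o _ = fst \o (@tnth n (T1 * T2)%type ^~ i)).
    by apply: measurableT_comp; [exact: measurable_fst | exact: measurable_tnth].
  by apply/funext => t /=; rewrite tnth_map.
have msnd : measurable_fun setT (@snd_tuple T1 T2 n).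
  apply/measurable_fun_tnthP => i.
  rewrite (_ : _ \o _ = snd \o (@tnth n (T1 * T2)%type ^~ i)).
    by apply: measurableT_comp; [exact: measurable_snd | exact: measurable_tnth].
  by apply/funext => t /=; rewrite tnth_map.
rewrite -(@Rintegral_prod_bounded _ _ _ _ _ P1 P2 F C).
- rewrite /=; apply: eq_Rintegral => -[x z] _; apply: eq_iE => t /=.
  by congr H; exact/val_inj.
- apply: (measurable_iE (P1 \x P2)%E (F := fun (p : T1 * T2) (t : n.-tuple (T1 * T2)) =>
      H (cons_tuple p.1 (fst_tuple t)) (cons_tuple p.2 (snd_tuple t)))).
  apply: (measurableT_comp (g := fun p : (T1 * T2) * n.-tuple (T1 * T2) =>
    (cons_tuple p.1.1 (fst_tuple p.2), cons_tuple p.1.2 (snd_tuple p.2)))) mH _.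
  apply: measurable_fun_pair.
    apply: (measurable_cons (f := fun p : (T1 * T2) * n.-tuple (T1 * T2) => p.1.1)
      (g := fun p => fst_tuple p.2)).
      by apply: measurableT_comp => //; exact: measurable_fst.
    by apply: measurableT_comp => //; exact: measurable_snd.
  apply: (measurable_cons (f := fun p : (T1 * T2) * n.-tuple (T1 * T2) => p.1.2)
    (g := fun p => snd_tuple p.2)).
    by apply: measurableT_comp => //; exact: measurable_fst.
  by apply: measurableT_comp => //; exact: measurable_snd.
- move=> p; apply: iE_bounded => //.
  apply: (measurableT_comp (g := fun t : n.-tuple (T1 * T2) =>
    (cons_tuple p.1 (fst_tuple t), cons_tuple p.2 (snd_tuple t)))) mH _.
  apply: measurable_fun_pair.
    apply: (measurable_cons (f := fun _ : n.-tuple (T1 * T2) => p.1)) => //.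
  apply: (measurable_cons (f := fun _ : n.-tuple (T1 * T2) => p.2)) => //.
Qed.

(** * Correlated Gaussians and rounding *)

Section CorrelatedPair.
Variable R : realType.
(* [normal_prob] lives on [measurableTypeR R], whose display differs from that of
   the canonical measurable structure on [R], although the sigma-algebras agree. *)
Local Notation GR := (measurableTypeR R).
Local Notation gam := (normal_prob (0 : R) 1).
Local Notation PP := (gam \x gam)%E.
Local Notation W := (@prodw _ _ GR GR R (@gW R) (@gW R)).

Definition pairW := W.

Lemma pairW_ge1 z : 1 <= pairW z.
Proof. by apply: prodw_ge1 => x; exact: gW_ge1. Qed.

Lemma integrable_pairW : PP.-integrable setT (EFin \o pairW).
Proof.
by apply: integrable_prodw; [exact: gW_ge1 | exact: gW_ge1
  | exact: integrable_gW | exact: integrable_gW].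
Qed.

(** Means, variances and the correlation of the pair are all read off as instances of this single
    computation. *)
Lemma Rintegral_pair_quad (al be ga a b e : R) :
  Rintegral PP setT (fun z : GR * GR =>
    al + be * z.1 + ga * z.2 + a * z.1 ^+ 2 + b * (z.1 * z.2) + e * z.2 ^+ 2)
  = al + a + e.
Proof.
set F := (fun z : GR * GR => _).
have mF : measurable_fun setT F.
  rewrite /F; do ?[apply: measurable_funD | apply: measurable_funM
    | apply: measurable_funX] => //.
have bnd (z : GR * GR) : `|F z| <= (`|al| + `|be| + `|ga| + `|a| + `|b| + `|e|) * W z.
  have hx (x : R) : `|x| <= gW x.
    rewrite /gW ler_norml.
    by have := sqr_ge0 (1 - x); have := sqr_ge0 (1 + x);
      have := sqr_ge0 (x ^+ 2); move=> *; apply/andP; split; nra.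
  have hx2 (x : R) : `|x ^+ 2| <= gW x.
    rewrite /gW ger0_norm ?sqr_ge0 //.
    by have := sqr_ge0 x; have := sqr_ge0 (x ^+ 2); nra.
  have g1 (x : R) := gW_ge1 x.
  have w0 : 1 <= W z by exact: pairW_ge1.
  have wl y : y <= gW z.1 -> y <= W z.
    move=> h; apply: le_trans h _; rewrite /prodw ler_peMr //.
    exact: le_trans (g1 _).
  have wr y : y <= gW z.2 -> y <= W z.
    move=> h; apply: le_trans h _; rewrite /prodw ler_peMl //.
    exact: le_trans (g1 _).
  have t1 : `|be * z.1| <= `|be| * W z by rewrite normrM ler_wpM2l // wl.
  have t2 : `|ga * z.2| <= `|ga| * W z by rewrite normrM ler_wpM2l // wr.
  have t3 : `|a * z.1 ^+ 2| <= `|a| * W z by rewrite normrM ler_wpM2l // wl.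
  have t4 : `|b * (z.1 * z.2)| <= `|b| * W z.
    by rewrite normrM ler_wpM2l // normrM /prodw ler_pM.
  have t5 : `|e * z.2 ^+ 2| <= `|e| * W z by rewrite normrM ler_wpM2l // wr.
  have t0 : `|al| <= `|al| * W z by rewrite ler_peMr.
  rewrite !mulrDl /F.
  by do 5 (apply: le_trans (ler_normD _ _) _; apply: lerD => //).
apply: etrans (@Rintegral_prod1 _ _ GR GR R _ _ _ _ (@gW_ge1 R) (@gW_ge1 R)
  (@integrable_gW R) (@integrable_gW R) _ _ mF bnd) _.
have N (a0 a1 a2 : R) :
    Rintegral gam setT (fun x : GR => a0 + a1 * x + a2 * x ^+ 2) = a0 + a2.
  transitivity (Rintegral gam setT (pol (fun x : GR => x : R) a0 a1 a2 0)).
    by apply: eq_Rintegral => x _; rewrite /pol mul0r addr0.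
  apply: etrans (@Rintegral_pol _ GR R gam (@gW R) (@gW_ge1 R) (@integrable_gW R)
    _ (@std_rv_normal R) _ _ _ _) _.
  by rewrite mul0r addr0.
transitivity (Rintegral gam setT (fun x : GR => (al + e) + be * x + a * x ^+ 2)).
  apply: eq_Rintegral => x _.
  transitivity (Rintegral gam setT
    (fun y : GR => (al + be * x + a * x ^+ 2) + (ga + b * x) * y + e * y ^+ 2)).
    by apply: eq_Rintegral => y _; rewrite /F /=; ring.
  by rewrite N; ring.
by rewrite N; ring.
Qed.

Variable rho : R.
Hypothesis hrho : rho ^+ 2 <= 1.

Definition corr (z : GR * GR) : R := rho * z.1 + Num.sqrt (1 - rho ^+ 2) * z.2.

Let s2 : Num.sqrt (1 - rho ^+ 2) ^+ 2 = 1 - rho ^+ 2.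
Proof. by rewrite sqr_sqrtr // subr_ge0. Qed.

Lemma std_rv_fst : std_rv PP pairW (fun z => z.1 : R).
Proof.
split.
- exact: measurable_fst.
- move=> z; rewrite /pairW /prodw /gW ler_peMr ?sqr_ge0 //; exact: gW_ge1.
- rewrite -[RHS](_ : 0 + 0 + 0 = 0 :> R); last by rewrite !addr0.
  rewrite -(Rintegral_pair_quad 0 1 0 0 0 0).
  by apply: eq_Rintegral => z _ /=; ring.
- rewrite -[RHS](_ : 0 + 1 + 0 = 1 :> R); last by rewrite addr0 add0r.
  rewrite -(Rintegral_pair_quad 0 0 0 1 0 0).
  by apply: eq_Rintegral => z _ /=; ring.
Qed.

Lemma std_rv_corr : std_rv PP pairW corr.
Proof.
split.
- by rewrite /corr; apply: measurable_funD; apply: measurable_funM.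
- move=> [x y]; rewrite /pairW /prodw /gW /corr /= -exprMn.
  set c := Num.sqrt _.
  rewrite lerXn2r ?nnegrE ?mulr_ge0 ?addr_ge0 ?sqr_ge0 //.
  (* Cauchy-Schwarz for the unit vector (rho, c): the square of rho x + c y is at most x^2 + y^2. *)
  have := sqr_ge0 (c * x - rho * y); have := sqr_ge0 (x * y).
  have e : (c * x - rho * y) ^+ 2 = (c ^+ 2 + rho ^+ 2) * (x ^+ 2 + y ^+ 2)
     - (rho * x + c * y) ^+ 2 by ring.
  rewrite e s2 subrK mul1r => h1 h2.
  rewrite (_ : (1 + x ^+ 2) * (1 + y ^+ 2) = 1 + (x ^+ 2 + y ^+ 2) + (x * y) ^+ 2).
    by lra.
  by ring.
- rewrite -[RHS](_ : 0 + 0 + 0 = 0 :> R); last by rewrite !addr0.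
  rewrite -(Rintegral_pair_quad 0 rho (Num.sqrt (1 - rho ^+ 2)) 0 0 0).
  by apply: eq_Rintegral => z _; rewrite /corr; ring.
- rewrite -[RHS](_ : 0 + rho ^+ 2 + Num.sqrt (1 - rho ^+ 2) ^+ 2 = 1 :> R).
    rewrite -(Rintegral_pair_quad 0 0 0 _ (2 * rho * Num.sqrt (1 - rho ^+ 2))).
    by apply: eq_Rintegral => z _; rewrite /corr; ring.
  by rewrite s2; ring.
Qed.

Lemma Rintegral_corr : Rintegral PP setT (fun z => z.1 * corr z) = rho.
Proof.
rewrite -[RHS](_ : 0 + rho + 0 = rho :> R); last by rewrite addr0 add0r.
rewrite -(Rintegral_pair_quad 0 0 0 rho (Num.sqrt (1 - rho ^+ 2)) 0).
by apply: eq_Rintegral => z _; rewrite /corr; ring.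
Qed.

Lemma GStab_iE n k (g : n.-tuple R -> k.-tuple R) : measurable_fun setT g ->
  (forall x, in_ball (g x)) -> GStab rho g
  = iE PP (fun t : n.-tuple (GR * GR) =>
      dotp (g (fst_tuple t)) (g [tuple of map corr t])).
Proof.
move=> mg hg.
have mg' : @measurable_fun _ _ (n.-tuple GR) (k.-tuple R) setT g by exact: mg.
pose H (x z : n.-tuple GR) := dotp (g x) (g (corr_mix rho x z)).
(* [gaussE] and [iE gam] are convertible. *)
transitivity (iE gam (fun x => iE gam (H x))); first by [].
apply: etrans (@iE_iE_pair _ _ _ _ _ _ _ _ H 1 _ _) _; last 1 first.
- apply: eq_iE => t; rewrite /H; congr (dotp _ (g _)).
  by apply: eq_from_tnth => i; rewrite tnth_mktuple !tnth_map.
- rewrite /H /dotp; apply: measurable_fun_sumr => i; apply: measurable_funM.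
    apply: (measurableT_comp (measurable_tnth i)).
    by apply: (measurableT_comp mg'); exact: measurable_fst.
  apply: (measurableT_comp (measurable_tnth i)).
  apply: (measurableT_comp mg'); apply/measurable_fun_tnthP => j.
  rewrite (_ : _ \o _ = (fun p : n.-tuple GR * n.-tuple GR =>
     rho * tnth p.1 j + Num.sqrt (1 - rho ^+ 2) * tnth p.2 j)).
    apply: measurable_funD; apply: measurable_funM => //.
      by apply: (measurableT_comp (measurable_tnth j)); exact: measurable_fst.
    by apply: (measurableT_comp (measurable_tnth j)); exact: measurable_snd.
  by apply/funext => p /=; rewrite tnth_mktuple.
- move=> x z; rewrite /H dotp_row.
  have := hg x; have := hg (corr_mix rho x z); rewrite /in_ball !dotp_row => h1 h2.
  by apply: le_trans (dot_young _ _ ltr01) _; rewrite invr1 !mul1r; lra.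
Qed.

End CorrelatedPair.

(** * Change of dimension and rounding into the ball *)

Section Padding.
Variables (R : realType) (k : nat).

(** The integrand is a function of sequences, so that [drop] and [take] require no casts between
    tuple types. *)
Lemma gaussE_drop j n (F : seq R -> R) :
  gaussE (fun t : (j + n).-tuple R => F (drop j t))
  = gaussE (fun t : n.-tuple R => F t).
Proof.
elim: j => [|j IH] /=.
  by congr gaussE; apply/funext => t; rewrite drop0.
by under eq_Rintegral do rewrite IH; rewrite Rintegral_prob_cst.
Qed.

Lemma gaussE_take j n (F : seq R -> R) :
  gaussE (fun t : (j + n).-tuple R => F (take j t))
  = gaussE (fun t : j.-tuple R => F t).
Proof.
elim: j F => [|j IH] F /=.
  transitivity (gaussE (fun _ : n.-tuple R => F [::])).
    by congr gaussE; apply/funext => t; rewrite take0.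
  exact: (iE_cst (normal_prob 0 1)).
apply: eq_Rintegral => x _; exact: (IH (fun s => F (x :: s))).
Qed.

Definition corr_mix_seq (rho : R) (x z : seq R) : seq R :=
  [seq rho * p.1 + Num.sqrt (1 - rho ^+ 2) * p.2 | p <- zip x z].

Lemma corr_mix_seqE n rho (x z : n.-tuple R) :
  corr_mix rho x z = corr_mix_seq rho x z :> seq R.
Proof.
apply: (@eq_from_nth _ 0); rewrite size_tuple.
  by rewrite size_map size_zip !size_tuple minnn.
move=> i hi; rewrite (nth_map (0, 0)); last by rewrite size_zip !size_tuple minnn.
rewrite nth_zip ?size_tuple //=.
have := tnth_nth 0 (corr_mix rho x z) (Ordinal hi) => /= <-.
by rewrite tnth_mktuple !(tnth_nth 0).
Qed.

Lemma drop_zip (A B : Type) j (s : seq A) (t : seq B) :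
  drop j (zip s t) = zip (drop j s) (drop j t).
Proof.
by elim: j s t => [|j IH] [|a s] [|b t] //=; rewrite ?drop0 //; case: (drop _ _).
Qed.

Lemma take_zip (A B : Type) j (s : seq A) (t : seq B) :
  take j (zip s t) = zip (take j s) (take j t).
Proof. by elim: j s t => [|j IH] [|a s] [|b t] //=; rewrite ?take0 // IH. Qed.

Lemma GStab_drop j n rho (Q : seq R -> k.-tuple R) :
  GStab rho (fun t : (j + n).-tuple R => Q (drop j t))
  = GStab rho (fun t : n.-tuple R => Q t).
Proof.
rewrite /GStab.
transitivity (gaussE (fun x : (j + n).-tuple R => gaussE (fun z : n.-tuple R =>
   dotp (Q (drop j x)) (Q (corr_mix_seq rho (drop j x) z))))).
  congr gaussE; apply/funext => x.
  rewrite -(gaussE_drop j n (fun z => dotp (Q (drop j x))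
    (Q (corr_mix_seq rho (drop j x) z)))).
  congr gaussE; apply/funext => z; rewrite corr_mix_seqE.
  by rewrite /corr_mix_seq -map_drop drop_zip.
rewrite (gaussE_drop j n (fun x => gaussE (fun z : n.-tuple R =>
   dotp (Q x) (Q (corr_mix_seq rho x z))))).
by congr gaussE; apply/funext => x; congr gaussE; apply/funext => z;
  rewrite corr_mix_seqE.
Qed.

Definition fopt_seq (x : seq R) : k.-tuple R :=
  let xk := [tuple nth 0 x i | i < k] in
  [tuple tnth xk i / Num.sqrt (dotp xk xk) | i < k].

Lemma fopt_seq_take x : fopt_seq (take k x) = fopt_seq x.
Proof.
have e : [tuple nth 0 (take k x) i | i < k] = [tuple nth 0 x i | i < k].
  by apply: eq_from_tnth => i; rewrite !tnth_mktuple nth_take.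
by rewrite /fopt_seq e.
Qed.

Lemma GStab_fopt n rho : GStab rho (@fopt R k (k + n)) = Fstar k rho.
Proof.
rewrite /Fstar /GStab.
transitivity (gaussE (fun x : (k + n).-tuple R => gaussE (fun z : k.-tuple R =>
   dotp (fopt_seq (take k x)) (fopt_seq (corr_mix_seq rho (take k x) z))))).
  congr gaussE; apply/funext => x.
  rewrite -(gaussE_take k n (fun z => dotp (fopt_seq (take k x))
    (fopt_seq (corr_mix_seq rho (take k x) z)))).
  congr gaussE; apply/funext => z; rewrite fopt_seq_take.
  rewrite /corr_mix_seq -take_zip map_take -/(corr_mix_seq rho x z).
  by rewrite -corr_mix_seqE fopt_seq_take.
rewrite (gaussE_take k n (fun x => gaussE (fun z : k.-tuple R =>
   dotp (fopt_seq x) (fopt_seq (corr_mix_seq rho x z))))).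
by congr gaussE; apply/funext => x; congr gaussE; apply/funext => z;
  rewrite -corr_mix_seqE.
Qed.

(** The hypothesis concerns dimensions at least k. Prepending k dummy coordinates reaches such a
    dimension for every n and changes neither stability. *)
Lemma Fstar_le n rho (Q : seq R -> k.-tuple R) : Hyp_k R k -> -1 <= rho <= 0 ->
  measurable_fun setT (fun t : n.-tuple R => Q t) -> (forall x, in_ball (Q x)) ->
  Fstar k rho <= GStab rho (fun t : n.-tuple R => Q t).
Proof.
move=> hyp hr mQ hQ.
rewrite -(GStab_fopt n) -(GStab_drop k n); apply: hyp => //; first exact: leq_addr.
pose dt (t : (k + n).-tuple R) : n.-tuple R := [tuple tnth t (rshift k i) | i < n].
rewrite (_ : (fun t => _) = (fun t : n.-tuple R => Q t) \o dt).
  apply: (measurableT_comp mQ); apply/measurable_fun_tnthP => i.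
  rewrite (_ : _ \o _ = @tnth (k + n) R ^~ (rshift k i)); first exact: measurable_tnth.
  by apply/funext => t /=; rewrite tnth_mktuple.
apply/funext => t /=; congr Q.
have sz : size (dt t) = n by exact: size_tuple.
apply: (@eq_from_nth _ 0) => [|i]; rewrite size_drop size_tuple addKn ?sz // => hi.
rewrite nth_drop -(tnth_nth 0 (dt t) (Ordinal hi)) tnth_mktuple.
by rewrite (tnth_nth 0).
Qed.

Definition rnd (u : 'rV[R]_k) : 'rV[R]_k := (Num.max 1 (dot u u))^-1 *: u.

Lemma rnd_in_ball u : dot (rnd u) (rnd u) <= 1.
Proof.
rewrite /rnd dotZl dotZr; set m := Num.max 1 _.
have m1 : 1 <= m by rewrite /m le_max lexx.
have mw : dot u u <= m by rewrite /m le_max lexx orbT.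
have mp : 0 < m by lra.
rewrite mulrA -invfM mulrC ler_pdivrMr ?mulr_gt0 // mul1r.
by have := dot_ge0 u; nra.
Qed.

(* Rounding by inversion instead of metric projection avoids square roots
   while still moving [u] by at most the excess of its squared norm over 1. *)
Lemma rnd_dist u : dot (u - rnd u) (u - rnd u) <= Num.max (dot u u - 1) 0.
Proof.
rewrite /rnd; set w := dot u u.
have -> : u - (Num.max 1 w)^-1 *: u = (1 - (Num.max 1 w)^-1) *: u.
  by rewrite scalerBl scale1r.
rewrite dotZl dotZr -/w.
have [w1|w1] := leP w 1.
  by rewrite invr1 subrr !mul0r le_max lexx orbT.
have -> : Num.max (w - 1) 0 = w - 1 by apply/max_idPl; lra.
have wp : 0 < w by lra.
have -> : (1 - w^-1) * ((1 - w^-1) * w) = (w - 1) * (1 - w^-1).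
  by field; exact: lt0r_neq0.
rewrite ler_piMr; [lra | lra |].
by rewrite lerBlDr lerDl invr_ge0 ltW.
Qed.

Lemma gauss_lower n rho (c : seq bool -> 'rV[R]_k) : Hyp_k R k -> -1 <= rho <= 0 ->
  Fstar k rho <= iE (normal_prob (0 : R) 1 \x normal_prob (0 : R) 1)%E
    (fun t : n.-tuple (measurableTypeR R * measurableTypeR R) =>
       dot (rnd (ev c [seq z.1 | z <- t])) (rnd (ev c [seq corr rho z | z <- t]))).
Proof.
move=> hyp hr.
pose Q (s : seq R) : k.-tuple R := [tuple rnd (ev c s) 0 j | j < k].
have QE s : row_of (Q s) = rnd (ev c s).
  by apply/rowP => j; rewrite mxE tnth_mktuple.
have hQ s : in_ball (Q s) by rewrite /in_ball dotp_row QE rnd_in_ball.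
have mQ : measurable_fun setT (fun t : n.-tuple R => Q t).
  apply/measurable_fun_tnthP => j.
  have me i : measurable_fun setT (fun t : n.-tuple R => ev c t 0 i).
    rewrite (_ : (fun t => _) = (fun t : n.-tuple R => ev c [seq id x | x <- t] 0 i)).
      by apply: measurable_ev; exact: measurable_id.
    by apply/funext => t; rewrite map_id.
  rewrite (_ : _ \o _ = (fun t : n.-tuple R =>
      (Num.max 1 (dot (ev c t) (ev c t)))^-1 * ev c t 0 j)).
    apply: measurable_funM => //; apply: measurable_funV.
      by apply: measurable_maxr => //; exact: measurable_dot.
    by move=> t; rewrite lt_max ltr01.
  by apply/funext => t /=; rewrite tnth_mktuple mxE.
apply: le_trans (Fstar_le hyp hr mQ hQ) _.
rewrite (GStab_iE rho mQ) // le_eqVlt; apply/orP; left; apply/eqP.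
by apply: eq_iE => t; rewrite dotp_row !QE.
Qed.

End Padding.

(** * Low-degree truncation *)

Lemma bernoulli_ge (R : realFieldType) (h : R) m : 0 <= h <= 1 ->
  1 - m%:R * h <= (1 - h) ^+ m.
Proof.
move=> /andP[h0 h1]; elim: m => [|m IH]; first by rewrite mul0r subr0 expr0.
rewrite exprS; apply: le_trans (ler_wpM2l _ IH); last by rewrite subr_ge0.
rewrite -natr1; have : 0 <= m%:R * h ^+ 2 by rewrite mulr_ge0 ?sqr_ge0.
by rewrite expr2; lra.
Qed.

Lemma expr_small (R : realType) (x e : R) : 0 <= x < 1 -> 0 < e ->
  exists N, x ^+ N <= e.
Proof.
move=> /andP[x0 x1] e0.
have xn : `|x| < 1 by rewrite ger0_norm.
have /cvgrPdist_le /(_ e e0) [N _ H] := cvg_expr xn.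
exists N; have := H N (leqnn N).
by rewrite /= sub0r normrN ger0_norm ?exprn_ge0.
Qed.

Lemma natV_small (R : realType) (e : R) : 0 < e -> exists r, r.+1%:R^-1 <= e.
Proof.
move=> e0; have ei : 0 <= e^-1 by rewrite invr_ge0 ltW.
exists (Num.bound e^-1); rewrite invf_ple ?posrE ?ltr0n //.
apply: le_trans (ltW (archi_boundP ei)) _.
by rewrite ler_nat.
Qed.

Section LowDegree.
Variables (R : realFieldType) (k : nat).
Variable f : seq bool -> 'rV[R]_k.
Hypothesis f1 : forall w, dot (f w) (f w) <= 1.
Variables (s : R) (d : nat).
Hypothesis s01 : 0 <= s <= 1.

Definition smooth w : 'rV[R]_k := s ^+ count id w *: hat f w.
Definition low w : 'rV[R]_k := if (count id w <= d)%N then smooth w else 0.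

Local Notation H w := (dot (hat f w) (hat f w)).

Let s0 : 0 <= s. Proof. by case/andP: s01. Qed.
Let s1 : s <= 1. Proof. by case/andP: s01. Qed.

Lemma sum_hat_le1 n : \sum_(w : n.-tuple bool) H w <= 1.
Proof.
apply: le_trans (Parseval_le1 n f1); apply: ler_sum => w _.
by rewrite expr1n mul1r.
Qed.

Lemma dot_low_le w : dot (low w) (low w) <= H w.
Proof.
rewrite /low; case: ifP => _; last by rewrite dot0l dot_ge0.
rewrite /smooth dotZl dotZr mulrA ler_piMl ?dot_ge0 //.
by rewrite -expr2 exprn_ile1 ?exprn_ge0 // exprn_ile1.
Qed.

Lemma wN1_low_le1 n : wN 1 n low <= 1.
Proof.
apply: le_trans (sum_hat_le1 n); apply: ler_sum => w _.
by rewrite expr1n mul1r dot_low_le.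
Qed.

(** A word with j letters [true] contributes an error |rho|^j (1 - t) times its weight. Up to j = N
    the factor t is close to 1; beyond N the power of |rho| is small. *)
Lemma low_stab (rho e : R) N n : `|rho| <= 1 -> (N <= d)%N -> 0 <= e ->
  `|rho| ^+ N <= e -> 1 - s ^+ N ^+ 2 <= e ->
  \sum_(w : n.-tuple bool) rho ^+ count id w * dot (low w) (low w)
  <= \sum_(w : n.-tuple bool) rho ^+ count id w * H w + e.
Proof.
move=> hr hN e0 hrN hsN.
rewrite -lerBlDl -sumrB.
apply: le_trans (_ : \sum_(w : n.-tuple bool) e * H w <= _); last first.
  by rewrite -mulr_sumr -[leRHS]mulr1 ler_wpM2l // sum_hat_le1.
apply: ler_sum => w _; set j := count id w.
have [t [E t0 t1 tN]] : exists t, [/\ dot (low w) (low w) = t * H w, 0 <= t,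
    t <= 1 & (j <= N)%N -> 1 - t <= e].
  rewrite /low -/j; case: ifP => hj.
    exists ((s ^+ j) ^+ 2); split.
    - by rewrite /smooth dotZl dotZr mulrA expr2.
    - exact: sqr_ge0.
    - by rewrite exprn_ile1 ?exprn_ge0 // exprn_ile1.
    - move=> jN; apply: le_trans hsN; rewrite lerD2l lerN2.
      by rewrite lerXn2r ?nnegrE ?exprn_ge0 // ler_wiXn2l.
  exists 0; split; rewrite ?dot0l ?mul0r // => jN.
  by rewrite (leq_trans jN hN) in hj.
rewrite E mulrA -mulrBl ler_wpM2r ?dot_ge0 //.
apply: le_trans (ler_norm _) _.
rewrite -[X in _ - X]mulr1 -mulrBr normrM normrX.
have u1 : `|t - 1| = 1 - t by rewrite ler0_norm ?opprB // subr_le0.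
have [jN|jN] := leqP j N.
  rewrite u1 -[e]mul1r ler_pM ?exprn_ge0 ?subr_ge0 ?tN //.
  by rewrite exprn_ile1.
rewrite u1 -[e]mulr1 ler_pM ?exprn_ge0 ?subr_ge0 //; last by lra.
by apply: le_trans hrN; rewrite ler_wiXn2l // ltnW.
Qed.

(** Truncation caps the weights at K^d, so the weighted influence is controlled by the low-degree
    influence of [f]. *)
Lemma wN_restr_low_le (K : R) n i : 1 <= K -> wN K n (restr i low)
  <= K ^+ d * \sum_(w : n.-tuple bool | (count id w <= d)%N && nth false w i) H w.
Proof.
move=> K1; have K0 : 0 <= K by exact: le_trans K1.
rewrite big_mkcond mulr_sumr; apply: ler_sum => w _.
rewrite /restr; case: (nth false w i); rewrite ?andbT ?andbF; last first.
  by rewrite dot0l !mulr0.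
have [hj|hj] := leqP (count id w) d.
  rewrite ler_pM ?exprn_ge0 ?dot_ge0 ?dot_low_le //.
  by rewrite ler_weXn2l.
by rewrite /low leqNgt hj /= dot0l !mulr0.
Qed.

(** Double counting: a set S is counted |S| <= d times. *)
Lemma sum_influence_le n :
  \sum_(i < n) \sum_(w : n.-tuple bool | (count id w <= d)%N && nth false w i) H w
  <= d%:R.
Proof.
under eq_bigr do rewrite big_mkcond.
rewrite exchange_big /=.
apply: le_trans (_ : \sum_(w : n.-tuple bool) d%:R * H w <= _); last first.
  by rewrite -mulr_sumr -[leRHS]mulr1 ler_wpM2l // sum_hat_le1.
apply: ler_sum => w _; rewrite -big_mkcond /=.
have [hj|hj] := leqP (count id w) d; last first.
  by rewrite big_pred0_eq mulr_ge0 ?dot_ge0.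
rewrite sumr_const -[X in X <= _]mulr_natl ler_wpM2r ?dot_ge0 // ler_nat.
apply: leq_trans hj; rewrite -sum1_card -sum1_count big_tuple.
apply: eq_leq; apply: eq_bigl => i.
by rewrite unfold_in /= (tnth_nth false).
Qed.

Lemma wN1_tail_le n : wN 1 n (fun w => low w - smooth w) <= (s ^+ d) ^+ 2.
Proof.
apply: le_trans (_ : \sum_(w : n.-tuple bool) (s ^+ d) ^+ 2 * H w <= _); last first.
  by rewrite -mulr_sumr -[leRHS]mulr1 ler_wpM2l ?sqr_ge0 // sum_hat_le1.
apply: ler_sum => w _; rewrite expr1n mul1r /low.
have [hj|hj] := leqP (count id w) d.
  by rewrite subrr dot0l mulr_ge0 ?sqr_ge0 ?dot_ge0.
rewrite sub0r -scaleN1r dotZl dotZr mulrA mulN1r opprK mul1r.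
rewrite /smooth dotZl dotZr mulrA -expr2 ler_wpM2r ?dot_ge0 //.
by rewrite lerXn2r ?nnegrE ?exprn_ge0 // ler_wiXn2l // ltnW.
Qed.

(** With u the truncation of v = T_s f, Young gives |u|^2 <= 1 + e + (1/e + 1) |u - v|^2. The mean
    of |u - v|^2 is at most s^(2d) <= e^2, so it costs e + e^2 <= 2e, and [er_le] adds one more
    e. *)
Lemma cube_excess (e : R) r n : 0 < e <= 1 -> s ^+ d <= e -> r.+1%:R^-1 <= e ->
  bE n (fun y => dot (ev low y) (ev low y) - 1 + er r (dot (ev low y) (ev low y)))
  <= 4 * e.
Proof.
move=> /andP[e0 e1] hs hr.
pose D y := dot (ev low y - ev smooth y) (ev low y - ev smooth y).
apply: le_trans (_ : bE n (fun y => 2 * e + (e^-1 + 1) * D y) <= _).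
  apply: le_bE => w _; set y := map _ w.
  set u := ev low y; set v := ev smooth y.
  have v1 : dot v v <= 1 by exact: (smooth_in_ball w s01 f1).
  have Du : dot u u <= 1 + e + (e^-1 + 1) * D y.
    have -> : dot u u = dot v v + 2 * dot v (u - v) + D y.
      by rewrite /D -/u -/v -dotDD addrC subrK.
    have := dot_young v (u - v) e0; rewrite ler_norml => /andP[_].
    rewrite -/(D y) => h.
    have := ler_wpM2l (ltW e0) v1.
    by rewrite mulrDl mul1r; lra.
  have D0 : 0 <= (e^-1 + 1) * D y.
    by rewrite mulr_ge0 ?dot_ge0 // addr_ge0 // invr_ge0 ltW.
  have := le_trans (er_le r (dot_ge0 u)) (lerD (lexx _) hr).
  move: D0 Du; rewrite -/u; move: (er _ _) ((e^-1 + 1) * _) => a b.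
  by have [m1|m1] := leP (1 - dot u u) 0; lra.
rewrite bED bEc bEZ.
have -> : bE n D = wN 1 n (fun w => low w - smooth w).
  by rewrite -bE_sqr; apply: eq_bE => w _; rewrite evB.
have t := wN1_tail_le n.
have t2 : (s ^+ d) ^+ 2 <= e ^+ 2 by rewrite lerXn2r ?nnegrE ?exprn_ge0 // ltW.
have ei : 0 <= e^-1 + 1 by rewrite addr_ge0 // invr_ge0 ltW.
have := ler_wpM2l ei (le_trans t t2).
have -> : (e^-1 + 1) * e ^+ 2 = e + e ^+ 2 by field; exact: lt0r_neq0.
have : e ^+ 2 <= e by rewrite expr2 ler_piMr // ltW.
lra.
Qed.

End LowDegree.

Lemma young_combine (R : realFieldType) (eta eta' x y z tp tq Ep Eq nq nr : R) :
  0 < eta -> 0 < eta' ->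
  `|x| <= (eta' * tp + eta * nq) / 2 -> `|y| <= (eta * nr + eta' * tq) / 2 ->
  tp <= Ep -> tq <= Eq -> nr <= 1 ->
  z - x - y <= z + eta' / 2 * Ep + eta' / 2 * Eq + eta / 2 * nq + eta / 2.
Proof.
move=> h h' hx hy hp hq hn.
have x1 : 0 <= eta' * (Ep - tp) by rewrite mulr_ge0 ?subr_ge0 // ltW.
have x2 : 0 <= eta' * (Eq - tq) by rewrite mulr_ge0 ?subr_ge0 // ltW.
have x3 : 0 <= eta * (1 - nr) by rewrite mulr_ge0 ?subr_ge0 // ltW.
move: hx hy; rewrite !ler_norml => /andP[hx _] /andP[hy _].
by lra.
Qed.

(** * Cost of rounding on the Gaussian side *)

Section GaussianExcess.
Context (dd : measure_display) (T : measurableType dd) (R : realType)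
  (P : probability T R).
Variable W : T -> R.
Hypothesis W1 : forall x, 1 <= W x.
Hypothesis iW : P.-integrable setT (EFin \o W).

Local Notation evX X c t := (ev c [seq X x | x <- t]).
Local Notation excess r u := (dot u u - 1 + er r (dot u u)).

(** The quadratic part equals its cube counterpart exactly, which leaves only the [er] term to
    [lindeberg]. *)
Lemma iE_excess (X : T -> R) r k n (c : seq bool -> 'rV[R]_k) : std_rv P W X ->
  iE P (fun t : n.-tuple T => excess r (evX X c t))
  = wN 1 n c - 1 + iE P (fun t : n.-tuple T => er r (dot (evX X c t) (evX X c t))).
Proof.
move=> sX.
have t1 := tame_dot_ev W1 sX n c.
have t2 := tame_er_ev W1 sX r n c.
have t0 := @tame_cst _ T _ W W1 n (-1).
rewrite (iED iW (tameD t1 t0) t2) (iED iW t1 t0) iE_cst; congr (_ - _ + _).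
rewrite (iE_dot_ev W1 iW n c c sX sX (rho := 1)) //.
by case: sX => _ _ _; under eq_Rintegral do rewrite expr2.
Qed.

(** Write <rnd p, rnd q> = <p, q> - <p - rnd p, q> - <rnd p, q - rnd q>. Young's inequality weights
    the rounding distances by 1/eta and the vectors q and rnd p by eta; the distances are below the
    excess, and the second moments at most 1. *)
Lemma iE_rnd_le (X Y : T -> R) rho (eta M : R) r k n (c : seq bool -> 'rV[R]_k) :
  std_rv P W X -> std_rv P W Y -> Rintegral P setT (fun x => X x * Y x) = rho ->
  0 < eta -> wN 1 n c <= 1 ->
  iE P (fun t : n.-tuple T => excess r (evX X c t)) <= M ->
  iE P (fun t : n.-tuple T => excess r (evX Y c t)) <= M ->
  iE P (fun t : n.-tuple T => dot (rnd (evX X c t)) (rnd (evX Y c t)))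
  <= \sum_(w : n.-tuple bool) rho ^+ count id w * dot (c w) (c w)
     + (eta^-1 * M + eta).
Proof.
move=> sX sY XY eta0 wc1 hX hY.
have mX : measurable_fun setT X by case: sX.
have mY : measurable_fun setT Y by case: sY.
have tX := tame_dot_ev W1 sX n c.
have tY := tame_dot_ev W1 sY n c.
have t0 a := @tame_cst _ T _ W W1 n a.
have tUX : tame W (fun t : n.-tuple T => excess r (evX X c t)).
  by apply: tameD (tame_er_ev W1 sX r n c); apply: tameD.
have tUY : tame W (fun t : n.-tuple T => excess r (evX Y c t)).
  by apply: tameD (tame_er_ev W1 sY r n c); apply: tameD.
have mrnd (Z : T -> R) : measurable_fun setT Z -> forall j,
    measurable_fun setT (fun t : n.-tuple T => rnd (evX Z c t) 0 j).
  move=> mZ j.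
  rewrite (_ : (fun t => _) = (fun t : n.-tuple T =>
      (Num.max 1 (dot (evX Z c t) (evX Z c t)))^-1 * evX Z c t 0 j)).
    apply: measurable_funM; last exact: measurable_ev.
    apply: measurable_funV; last by move=> t; rewrite lt_max ltr01.
    apply: measurable_maxr => //.
    by apply: measurable_dot => i; exact: measurable_ev.
  by apply/funext => t; rewrite mxE.
have tR : tame W (fun t : n.-tuple T => dot (rnd (evX X c t)) (rnd (evX Y c t))).
  apply: (tame_bounded W1 (C := 1)).
    by apply: measurable_dot => j; exact: mrnd.
  move=> t; apply: le_trans (dot_young _ _ ltr01) _.
  have := rnd_in_ball (evX X c t); have := rnd_in_ball (evX Y c t).
  by rewrite invr1 !mul1r; lra.
have tP : tame W (fun t : n.-tuple T => dot (evX X c t) (evX Y c t)).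
  apply: (tame_le _ _ (tameD tX tY)).
    by apply: measurable_dot => j; exact: measurable_ev.
  move=> t; apply: le_trans (dot_young _ _ ltr01) _.
  have := dot_ge0 (evX X c t); have := dot_ge0 (evX Y c t) => h1 h2.
  by rewrite ger0_norm ?addr_ge0 // invr1 !mul1r; lra.
have aX := tameZ (eta^-1 / 2) tUX; have aY := tameZ (eta^-1 / 2) tUY.
have bY := tameZ (eta / 2) tY.
apply: le_trans (iE_le iW tR
  (tameD (tameD (tameD (tameD tP aX) aY) bY) (t0 (eta / 2))) _) _.
  move=> t; set p := evX X c t; set q := evX Y c t.
  have ex (u : 'rV[R]_k) : dot (u - rnd u) (u - rnd u) <= excess r u.
    apply: le_trans (rnd_dist u) _.
    have := er_ge r (dot_ge0 u); have /andP[er0 _] := er_bounds r (dot_ge0 u).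
    by have [m1|m1] := leP (dot u u - 1) 0; lra.
  have li : 0 < eta^-1 by rewrite invr_gt0.
  have e1 := dot_young (p - rnd p) q li.
  have e2 := dot_young (rnd p) (q - rnd q) eta0.
  rewrite invrK in e1.
  have -> : dot (rnd p) (rnd q) = dot p q - dot (p - rnd p) q - dot (rnd p) (q - rnd q).
    by rewrite dotBl dotBr; ring.
  exact: young_combine eta0 li e1 e2 (ex p) (ex q) (rnd_in_ball p).
rewrite (iED iW (tameD (tameD (tameD tP aX) aY) bY) (t0 _)).
rewrite (iED iW (tameD (tameD tP aX) aY) bY) (iED iW (tameD tP aX) aY) (iED iW tP aX).
rewrite (iEZ iW _ tUX) (iEZ iW _ tUY) (iEZ iW _ tY) iE_cst.
rewrite (iE_dot_ev W1 iW n c c sX sY XY).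
have -> : iE P (fun t : n.-tuple T => dot (evX Y c t) (evX Y c t)) = wN 1 n c.
  rewrite (iE_dot_ev W1 iW n c c sY sY (rho := 1)) //.
  by case: sY => _ _ _; under eq_Rintegral do rewrite expr2.
have li : 0 <= eta^-1 / 2 by rewrite divr_ge0 // invr_ge0 ltW.
have x1 := ler_wpM2l li hX; have x2 := ler_wpM2l li hY.
have x3 := ler_wpM2l (_ : 0 <= eta / 2) wc1.
have := x3 ltac:(lra) => {}x3.
by lra.
Qed.

End GaussianExcess.

(** * The invariance principle *)

(** In the quadratic term one factor J i is bounded by [delta]; the other is summed to at most [d],
    independently of n. *)
Lemma sum_kap_le (R : realFieldType) n (l d K0 delta : R) (I J : 'I_n -> R) :
  0 < l -> 0 <= K0 -> 0 <= delta ->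
  (forall i, 0 <= I i <= K0 * J i) -> (forall i, 0 <= J i <= delta) ->
  \sum_i J i <= d ->
  \sum_i kap l (I i) <= d * (l * K0 + l^-1 * K0 ^+ 2 * delta).
Proof.
move=> l0 K00 d0 hI hJ hd.
have li : 0 <= l^-1 * K0 ^+ 2 by rewrite mulr_ge0 ?sqr_ge0 // invr_ge0 ltW.
apply: le_trans (_ : \sum_i J i * (l * K0 + l^-1 * K0 ^+ 2 * delta) <= _).
  apply: ler_sum => i _; have /andP[I0 IJ] := hI i; have /andP[J0 Jd] := hJ i.
  apply: le_trans (kap_le l0 I0 IJ) _; rewrite /kap.
  have -> : l * (K0 * J i) + l^-1 * (K0 * J i) ^+ 2
     = J i * (l * K0 + l^-1 * K0 ^+ 2 * J i) by ring.
  by rewrite ler_wpM2l // lerD2l ler_wpM2l.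
rewrite -mulr_suml ler_wpM2r // addr_ge0 //; first by rewrite mulr_ge0 // ltW.
by rewrite mulr_ge0.
Qed.

(* The parameter [l] balances the second- and fourth-order terms of the
   Lindeberg error; [delta] is chosen after it. *)
Lemma lindeberg_parameters (R : realFieldType) (C D K0 e : R) :
  0 <= C -> 0 <= D -> 0 <= K0 -> 0 < e ->
  exists l delta, [/\ 0 < l, 0 < delta &
    C * (D * (l * K0 + l^-1 * K0 ^+ 2 * delta)) <= e].
Proof.
move=> C0 D0 K00 e0.
pose A := C * D * K0 + 1; pose B := C * D * K0 ^+ 2 + 1.
have a0 : 0 <= C * D * K0 by rewrite !mulr_ge0.
have b0 : 0 <= C * D * K0 ^+ 2 by rewrite !mulr_ge0 ?sqr_ge0.
have A0 : 0 < A by rewrite /A; lra.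
have B0 : 0 < B by rewrite /B; lra.
pose l := e / (2 * A); have l0 : 0 < l by rewrite divr_gt0 // mulr_gt0.
pose delta := l * e / (2 * B).
have d0 : 0 < delta by rewrite divr_gt0 // mulr_gt0.
exists l, delta; split=> //.
have -> : C * (D * (l * K0 + l^-1 * K0 ^+ 2 * delta))
   = l * (C * D * K0) + (l^-1 * delta) * (C * D * K0 ^+ 2) by ring.
have h1 : l * (C * D * K0) <= l * A by rewrite ler_pM2l // /A; lra.
have ld : 0 < l^-1 * delta by rewrite mulr_gt0 // invr_gt0.
have h2 : l^-1 * delta * (C * D * K0 ^+ 2) <= l^-1 * delta * B.
  by rewrite ler_pM2l // /B; lra.
have e1 : l * A = e / 2 by rewrite /l; field; exact: lt0r_neq0.
have e2 : l^-1 * delta * B = e / 2.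
  by rewrite /delta; field; rewrite !lt0r_neq0.
by lra.
Qed.

Lemma excess_transfer (R : realFieldType) (w a b e : R) :
  w + b <= 4 * e -> `|a - b| <= e -> w + a <= 5 * e.
Proof. by move=> h; rewrite ler_norml => /andP[_]; lra. Qed.

Lemma stab_budget (R : realFieldType) (F S B e eta eps : R) :
  F <= S + (5 * eta + eta) -> S <= B + e -> e <= eta -> eta <= eps / 7 ->
  F - eps <= B.
Proof. lra. Qed.

Unset Implicit Arguments.

Theorem theorem10p1 (R : realType) (k : nat) :
  (1 <= k)%N -> Hyp_k R k ->
  forall rho : R, -1 < rho <= 0 ->
  forall eps : R, 0 < eps ->
  exists delta : R, 0 < delta /\
  exists m : nat,
    forall (n : nat) (f : {ffun 'I_n -> bool} -> k.-tuple R),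
      (forall x, in_ball (f x)) ->
      (forall i : 'I_n,
         \sum_(j < k) Inf_le m i (fun x => tnth (f x) j) <= delta) ->
      Fstar k rho - eps <= BStab rho f.
Proof.
move=> _ hyp rho /andP[r1 r0] eps eps0.
(* The budget: 5 eta from the excess, eta from Young's inequality, and e <= eta from truncation. *)
pose eta := Num.min 1 (eps / 7).
have eta0 : 0 < eta by rewrite lt_min ltr01 divr_gt0.
have eta1 : eta <= 1 by rewrite ge_min lexx.
have eta7 : eta <= eps / 7 by rewrite ge_min lexx orbT.
(* The excess bound 5e is divided by eta in [iE_rnd_le], so e is taken quadratic in eta. *)
pose e := eta ^+ 2.
have e0 : 0 < e by rewrite exprn_gt0.
have e1 : e <= 1 by rewrite exprn_ile1 // ltW.
have ar : 0 <= `|rho| < 1 by rewrite normr_ge0 ler0_norm //; lra.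
have ar1 : `|rho| <= 1 by case/andP: ar => _ /ltW.
have [N hN] := expr_small ar e0.
(* Bernoulli bounds 1 - s^(2N) by 2N h <= e for s = 1 - h; the successor keeps the denominator
   positive when N = 0. *)
pose h := e / (2 * N).+1%:R.
have N0 : 0 < (2 * N).+1%:R :> R by rewrite ltr0n.
have h0 : 0 < h by rewrite divr_gt0.
have hN2 : (2 * N)%:R * h <= e.
  rewrite /h mulrCA ler_piMr ?(ltW e0) // ler_pdivrMr // mul1r ler_nat.
  exact: leqnSn.
have h1 : h <= 1.
  rewrite /h ler_pdivrMr // mul1r; apply: le_trans e1 _.
  by rewrite ler1n.
pose s := 1 - h.
have s01 : 0 <= s <= 1 by rewrite /s; lra.
have s01' : 0 <= s < 1 by rewrite /s; lra.
have hsN : 1 - s ^+ N ^+ 2 <= e.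
  have := @bernoulli_ge R h (2 * N) ltac:(lra).
  by rewrite -/s -exprM mulnC; lra.
have [d0 hd0] := expr_small s01' e0.
(* [low_stab] needs d >= N, and d >= d0 makes s^d at most e. This d is also the degree m of the
   theorem. *)
pose d := maxn N d0.
have Nd : (N <= d)%N by exact: leq_maxl.
have hd : s ^+ d <= e.
  apply: le_trans hd0; case/andP: s01 => s0 s1.
  by rewrite ler_wiXn2l // leq_maxr.
have [r hr] := natV_small e0.
have rho2 : rho ^+ 2 <= 1 by rewrite -real_normK ?num_real // exprn_ile1.
have W1 := @pairW_ge1 R; have iW := @integrable_pairW R.
have sX := @std_rv_fst R; have sY := std_rv_corr rho2.
have [C1 C10 L1] := lindeberg W1 iW sX r.
have [C2 C20 L2] := lindeberg W1 iW sY r.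
set K1 := hyperK _ _ in L1; set K2 := hyperK _ _ in L2.
have K1p : 1 <= K1.
  by apply: le_trans (hyperK_ge4 _ _); rewrite ler1n.
have K2p : 1 <= K2.
  by apply: le_trans (hyperK_ge4 _ _); rewrite ler1n.
pose C := C1 + C2; pose K0 := K1 ^+ d + K2 ^+ d.
have K1d : 0 <= K1 ^+ d by rewrite exprn_ge0 // (le_trans ler01 K1p).
have K2d : 0 <= K2 ^+ d by rewrite exprn_ge0 // (le_trans ler01 K2p).
have K00 : 0 <= K0 by rewrite addr_ge0.
have C0 : 0 <= C by rewrite addr_ge0.
have [l [delta [l0 delta0 hl]]] := lindeberg_parameters C0 (ler0n R d) K00 e0.
exists delta; split=> //; exists d => n f hf hInf.
pose F := word_fun f.
have F1 w : dot (F w) (F w) <= 1 by rewrite -dotp_row; exact: hf.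
pose c := low F s d.
pose J (i : 'I_n) := \sum_(w : n.-tuple bool | (count id w <= d)%N && nth false w i)
  dot (hat F w) (hat F w).
have hJ i : 0 <= J i <= delta.
  rewrite sumr_ge0 => [/=|w _]; last exact: dot_ge0.
  by have := hInf i; rewrite sum_Inf_le.
have sJ : \sum_i J i <= d%:R by exact: sum_influence_le.
have lin (K C' : R) : 1 <= K -> K ^+ d <= K0 -> 0 <= C' -> C' <= C ->
    C' * \sum_(i < n) kap l (wN K n (restr i c)) <= e.
  move=> Kp KK C'0 C'C; apply: le_trans hl.
  have hI (i : 'I_n) : 0 <= wN K n (restr i c) <= K0 * J i.
    have /andP[J0 _] := hJ i.
    rewrite wN_ge0 ?(le_trans ler01 Kp) //=.
    apply: le_trans (wN_restr_low_le F d s01 n i Kp) _.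
    by rewrite ler_wpM2r.
  have S := sum_kap_le l0 K00 (ltW delta0) hI hJ sJ.
  apply: le_trans (ler_wpM2l C'0 S) _.
  rewrite ler_wpM2r // mulr_ge0 // addr_ge0 // ?mulr_ge0 ?sqr_ge0 ?invr_ge0 //;
    exact: ltW.
have e01 : 0 < e <= 1 by rewrite e0 e1.
have B4 := cube_excess F1 s01 n e01 hd hr.
have wc1 : wN 1 n c <= 1 by exact: wN1_low_le1.
have bEE : bE n (fun y => dot (ev c y) (ev c y) - 1 + er r (dot (ev c y) (ev c y)))
   = wN 1 n c - 1 + bE n (fun y => er r (dot (ev c y) (ev c y))).
  by rewrite bED bEB bEc bE_sqr.
have hX : C1 * \sum_(i < n) kap l (wN K1 n (restr i c)) <= e.
  by apply: lin => //; rewrite lerDl.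
have hY : C2 * \sum_(i < n) kap l (wN K2 n (restr i c)) <= e.
  by apply: lin => //; rewrite lerDr.
have {}hX := le_trans (L1 k n c l l0) hX; have {}hY := le_trans (L2 k n c l l0) hY.
rewrite -/c bEE in B4.
have M1 := iE_excess W1 iW r n c sX; have M2 := iE_excess W1 iW r n c sY.
have hrho : -1 <= rho <= 0 by rewrite (ltW r1) r0.
have low1 := gauss_lower n c hyp hrho.
have st := low_stab F1 s01 n ar1 Nd (ltW e0) hN hsN.
have ee : e <= eta by rewrite /e expr2 ler_piMr // ltW.
rewrite BStabE; apply: stab_budget _ st ee eta7.
have <- : eta^-1 * (5 * e) = 5 * eta by rewrite /e; field; exact: lt0r_neq0.
apply: le_trans low1 _.
apply: (iE_rnd_le W1 iW sX sY (Rintegral_corr rho) eta0 wc1 (r := r)).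
  by rewrite M1; exact: excess_transfer B4 hX.
by rewrite M2; exact: excess_transfer B4 hY.
Qed.
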